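(* Let $(M,g)$ be a connected $m$-dimensional Riemannian manifold with inner metric $d_g$. (i) Let $\Theta$ be any relatively compact subset of $M$. Then there exist a compact subset $K_m$ of $\mathbb{R}^m$ as well as $r\in\mathbb{N}$ and $\delta>0$ such that $$N(\Theta,d_g,\eta)\le r\,N(K_m,d_{m,2},\eta/\delta)\quad\text{for all }\eta>0,$$ where $d_{m,2}$ stands for the Euclidean metric on $\mathbb{R}^m$. As a consequence, there exists $C>0$ such that $N(\Theta,d_g,\eta)\le C\eta^{-m}$ for all $\eta\in\,]0,\Delta(\Theta)]$. (ii) If $d_g$ is complete, then for every $d_g$-bounded subset $\Theta$ of $M$ there exists $C>0$ such that $N(\Theta,d_g,\eta)\le C\eta^{-m}$ for all $\eta\in\,]0,\Delta(\Theta)]$.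
   Context: $M$ is an $m$-dimensional $C^\infty$-manifold with a ($C^\infty$) Riemannian metric $g$. For $p,q\in M$, $\mathcal{C}_{pq}$ is the set of $C^\infty$-curves in $M$ joining $p$ to $q$; the length of $c\in\mathcal{C}_{pq}$ defined on the closed interval $I_c$ is $L(c)=\int_{I_c}\sqrt{g_{c(t)}(c'(t),c'(t))}\,dt$; and $d_g(p,q)=\inf_{c\in\mathcal{C}_{pq}}L(c)$ is the inner metric, which induces the topology of $M$. For a metric $d$ and a set $S$, $N(S,d,\eta)$ is the minimal number of closed $d$-balls of radius $\eta>0$ with centers in $S$ needed to cover $S$. $\Delta(\Theta)$ is the diameter of $\Theta$ w.r.t. $d_g$. $]a,b]$ denotes a half-open interval. *)

(* Defs.v *)
From HB Require Import structures.
From mathcomp Require Import all_boot all_order all_algebra.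
From mathcomp Require Import all_classical all_reals all_analysis.

Set Implicit Arguments.
Unset Strict Implicit.
Unset Printing Implicit Defensive.

Import Order.TTheory GRing.Theory Num.Theory.
Import numFieldNormedType.Exports.

Local Open Scope classical_set_scope.
Local Open Scope ring_scope.

(* U is meant to be open: [differentiable f x] and [{for x, continuous f}]
   refer to the values of f on a full neighbourhood of x. *)
Fixpoint Ck_on (R : realType) (V W : normedModType R) (k : nat)
    (U : set V) (f : V -> W) : Prop :=
  match k with
  | 0 => forall x, U x -> {for x, continuous f}
  | k'.+1 => (forall x, U x -> differentiable f x) /\
             (forall v, Ck_on k' U ('D_v f))
  end.

Definition smooth_on (R : realType) (V W : normedModType R)
    (U : set V) (f : V -> W) : Prop :=
  forall k, Ck_on k U f.

(* [param i] is the inverse of the chart [coord i] on its image; the values of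
   [coord i] outside [dom i] and of [param i] outside [coord i @` dom i] play no
   role.  The atlas need not be maximal: none of the notions below changes when
   compatible charts are added. *)
Record smooth_manifold (R : realType) (m : nat) (M : topologicalType) :=
  SmoothManifold {
  chart : Type;
  dom : chart -> set M;
  coord : chart -> M -> 'rV[R]_m;
  param : chart -> 'rV[R]_m -> M;
  manifold_hausdorff : hausdorff_space M;
  manifold_second_countable : @second_countable M;
  dom_cover : forall p, exists i, dom i p;
  dom_open : forall i, open (dom i);
  coord_dom_open : forall i, open (coord i @` dom i);
  coordK : forall i p, dom i p -> param i (coord i p) = p;
  coord_continuous : forall i p, dom i p -> {for p, continuous (coord i)};
  param_continuous : forall i x, (coord i @` dom i) x ->
    {for x, continuous (param i)};
  transition_smooth : forall i j,
    smooth_on (coord i @` (dom i `&` dom j)) (coord j \o param i)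
}.

Section TangentSpaces.
Context {R : realType} {m : nat} {M : topologicalType}.
Variable A : smooth_manifold R m M.

(* A tangent vector at p is the family of its components in all the charts at
   p, related by the differentials of the transition maps; the components in
   the other charts are set to 0, so that T_pM is a linear subspace of
   [chart A -> 'rV[R]_m]. *)
Definition tangent (p : M) (v : chart A -> 'rV[R]_m) : Prop :=
  (forall i j, dom i p -> dom j p ->
     v j = 'D_(v i) (coord j \o param i) (coord i p)) /\
  (forall i, ~ dom i p -> v i = 0).

(* The element of T_pM whose component in the chart i is w (for p in dom i);
   w = delta_mx 0 k gives the k-th coordinate vector field. *)
Definition coord_vector (i : chart A) (w : 'rV[R]_m) (p : M) :
    chart A -> 'rV[R]_m :=
  fun j => if p \in dom j then 'D_w (coord j \o param i) (coord i p) else 0.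

Definition velocity (c : R -> M) (t : R) : chart A -> 'rV[R]_m :=
  fun i => if c t \in dom i then 'D_1 (coord i \o c : R^o -> 'rV[R]_m) t else 0.

(* Only the values of [metric p] on T_pM x T_pM matter. *)
Record riemannian_metric := RiemannianMetric {
  metric :> M -> (chart A -> 'rV[R]_m) -> (chart A -> 'rV[R]_m) -> R;
  metric_sym : forall p u v, tangent p u -> tangent p v ->
    metric p u v = metric p v u;
  metric_linear : forall p (a : R) u v w,
    tangent p u -> tangent p v -> tangent p w ->
    metric p (a *: u + v) w = a * metric p u w + metric p v w;
  metric_pos : forall p v, tangent p v -> v != 0 -> 0 < metric p v v;
  metric_smooth : forall i (u v : 'rV[R]_m),
    smooth_on (coord i @` dom i)
      (fun x => metric (param i x) (coord_vector i u (param i x))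
                  (coord_vector i v (param i x)) : R^o)
}.

(* Smoothness on the closed interval [a, b] is smoothness of an extension to an
   open neighbourhood of it. *)
Definition smooth_curve (a b : R) (c : R -> M) : Prop :=
  exists U : set R, [/\ open U, `[a, b] `<=` U,
    forall t, U t -> {for t, continuous c} &
    forall i : chart A, smooth_on (U `&` c @^-1` dom i : set R^o)
      (coord i \o c : R^o -> 'rV[R]_m)].

Variable g : riemannian_metric.

Definition curve_length (a b : R) (c : R -> M) : R :=
  \int[lebesgue_measure]_(t in `[a, b])
    Num.sqrt (g (c t) (velocity c t) (velocity c t)).

Definition inner_metric (p q : M) : R :=
  inf [set l : R | exists a b c,
    [/\ a < b, smooth_curve a b c, c a = p, c b = q &
        l = curve_length a b c]].

End TangentSpaces.

Section Metrics.
Context {R : realType} {T : Type}.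
Implicit Types (d : T -> T -> R) (S : set T).

(* The value is +oo if no finite cover exists. *)
Definition covering_number S d (eta : R) : \bar R :=
  ereal_inf [set n%:R%:E | n in [set n : nat | exists x : 'I_n -> T,
    (forall i, S (x i)) /\
    S `<=` \bigcup_i [set y | d (x i) y <= eta]]].

(* In \bar R: -oo for the empty set and +oo for unbounded sets. *)
Definition diameter d S : \bar R :=
  ereal_sup [set e | exists x y, [/\ S x, S y & e = (d x y)%:E]].

Definition metric_bounded d S : Prop :=
  exists B : R, forall x y, S x -> S y -> d x y <= B.

Definition metric_complete d : Prop :=
  forall u : nat -> T,
    (forall e : R, 0 < e -> exists N : nat, forall k l : nat,
       (N <= k)%N -> (N <= l)%N -> d (u k) (u l) < e) ->
    exists l, d (u n) l @[n --> \oo] --> (0 : R).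

End Metrics.

Definition euclidean_dist (R : realType) (m : nat) (x y : 'rV[R]_m) : R :=
  Num.sqrt (\sum_(k < m) (x 0 k - y 0 k) ^+ 2).

(* Main.v *)
From Pilot Require Import Defs.
From mathcomp Require Import all_boot all_order all_algebra.
From mathcomp Require Import all_classical all_reals all_analysis.
From mathcomp Require Import ring lra.
Import Pilot.Defs.
Import Order.TTheory GRing.Theory Num.Theory.
Import numFieldNormedType.Exports.
Local Open Scope classical_set_scope.
Local Open Scope ring_scope.
Set Implicit Arguments.
Unset Strict Implicit.

(** Let d be the inner metric.  Everything reduces to one notion,
[piecewise_lipschitz]: a set is cut into finitely many pieces, each carrying
bounded coordinates in R^m for which d is at most a constant times the
coordinate distance.  Such a set inherits the covering numbers of a bounded
part of R^m.  A cover of the coordinate range by Euclidean balls, or by the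
cells of a cubic grid, induces one of the set: choose one point of the set for
every piece and every ball or cell that meets it.  The chosen points are within
twice the radius of the ball, or one side of the cell, of all others, which is
absorbed by the Lipschitz constant.  Balls give the comparison with N(K, -)
([piecewise_lipschitz_covering_le]), the grid gives C eta^-m
([piecewise_lipschitz_covering_polynomial]); the latter only concerns eta
bounded by the diameter, so it needs a finite diameter.

Small coordinate balls are piecewise Lipschitz: they are convex in the chart
and the coefficients of g are bounded there, so that a coordinate segment has
length at most C |x - y| ([chart_segment_joined]).  A precompact set is covered
by finitely many of them, which settles (i): its diameter is finite by the
triangle inequality, and connectedness provides a curve between any two points
([joined_exists]).

For (ii) it remains to see that d-bounded sets are piecewise Lipschitz when d
is complete, which is the Hopf-Rinow theorem in the form needed here
([complete_ball_piecewise_lipschitz]).  If all balls of radius eps centered in a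
given ball are piecewise Lipschitz, then so is the given ball: one enlarges the
radius by steps of eps / 4, using that d is a length metric.  Hence a ball that
is not piecewise Lipschitz contains centers of arbitrarily small such balls;
iterating with radii 2^-n yields a Cauchy sequence, and balls this small near
its limit lie in a coordinate ball, a contradiction.

Three facts about d have to be extracted from its definition as an infimum over
smooth curves.
- The triangle inequality ([joined_trans]): a concatenation has a corner, which
  is removed by slowing both curves down with a reparametrization all of whose
  derivatives vanish at the junction ([flat_ramp]).  Length does not change.
- Points that are d-close to p lie in any given neighbourhood of p
  ([chart_escape]): a curve that leaves a coordinate ball must cross it, and the
  form g is bounded below there.
- d is a length metric ([inner_metric_split]): a curve can be cut at any
  intermediate value of its arc length.
Lengths enter only through antiderivatives of the speed
([arc_length_function]), so that restriction, reversal, reparametrization and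
concatenation of curves become statements about derivatives. *)

(** * Differentiation along curves *)

Section CkLine.
Context {R : realType}.

Lemma near_open_eq (T : topologicalType) (S : Type) (B : set T) (f g : T -> S) x :
  open B -> B x -> (forall y, B y -> f y = g y) -> \forall y \near x, f y = g y.
Proof.
move=> oB Bx fg; near=> y; apply: fg.
by near: y; exact: open_nbhs_nbhs.
Unshelve. all: by end_near. Qed.

(** Lets a glued curve be described by different formulas near different
parameters. *)
Lemma Ck_local (W : normedModType R) k (U : set R^o) (f : R^o -> W) :
  (forall x, U x -> exists B (g : R^o -> W),
     [/\ open B, B x, Ck_on k B g & forall y, B y -> f y = g y]) ->
  Ck_on k U f.
Proof.
elim: k f => [|k IH] f H /=.
  move=> x /H[B [g [oB Bx cg fg]]].
  have nfg := near_open_eq oB Bx fg.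
  suff : f @ x --> g x by rewrite -(fg _ Bx).
  apply: cvg_trans (cg _ Bx); apply: near_eq_cvg.
  by apply: filterS nfg => y ->.
split=> [x /H[B [g [oB Bx [dg _] fg]]]|v].
  apply/derivable1_diffP/(near_eq_derivable (f := g)); last exact/derivable1_diffP/dg.
  by apply: (near_open_eq oB Bx) => y /fg.
apply: IH => x /H[B [g [oB Bx [_ dg] fg]]].
exists B, ('D_v g); split=> // [|y Oy]; [exact: dg|apply: near_eq_derive].
exact: (near_open_eq oB Oy).
Qed.

Lemma Ck_congr (W : normedModType R) k (U : set R^o) (f g : R^o -> W) :
  open U -> (forall x, U x -> f x = g x) -> Ck_on k U g -> Ck_on k U f.
Proof. by move=> oU fg cg; apply: Ck_local => x Ux; exists U, g. Qed.

Lemma Ck_subset (V W : normedModType R) k (U U' : set V) (f : V -> W) :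
  U' `<=` U -> Ck_on k U f -> Ck_on k U' f.
Proof.
move=> UU'; elim: k f => [|k IH] f /=; first by move=> cf x Ux; apply: cf; exact: UU'.
by move=> [df ddf]; split=> [x /UU'|v]; [apply: df|apply: IH].
Qed.

Lemma Ck_weaken (V W : normedModType R) k (U : set V) (f : V -> W) :
  Ck_on k.+1 U f -> Ck_on k U f.
Proof.
elim: k f => [|k IH] f /=.
  by move=> [df _] x Ux; apply/differentiable_continuous/df.
by move=> [df ddf]; split => // v; apply: IH; exact: ddf.
Qed.

Lemma Ck_add (W : normedModType R) k (U : set R^o) (f g : R^o -> W) :
  open U -> Ck_on k U f -> Ck_on k U g -> Ck_on k U (fun t => f t + g t).
Proof.
move=> oU; elim: k f g => [|k IH] f g /=.
  by move=> cf cg x Ux; apply: cvgD; [exact: cf|exact: cg].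
move=> [df ddf] [dg ddg]; split=> [x Ux|v].
  by apply: differentiableD; [exact: df|exact: dg].
apply: (Ck_congr (g := fun t => 'D_v f t + 'D_v g t)) => // [x Ux|]; last exact: IH.
by rewrite deriveD//; apply: diff_derivable; [exact: df|exact: dg].
Qed.

Lemma Ck_cst (V W : normedModType R) k (U : set V) (a : W) : Ck_on k U (cst a).
Proof.
elim: k a => [|k IH] a /=; first by move=> x _; exact: cst_continuous.
split=> [x _|v]; first exact: differentiable_cst.
have -> : 'D_v (cst a : V -> W) = cst 0 by apply/funext => x; rewrite derive_cst.
exact: IH.
Qed.

Lemma Ck_id (V : normedModType R) k (U : set V) : Ck_on k U (@id V).
Proof.
case: k => [|k] /=; first by move=> x _; exact: cvg_id.
split=> [x _|v]; first exact: ex_diff.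
have -> : 'D_v (@id V) = cst v by apply/funext => x; exact: derive_id.
exact: Ck_cst.
Qed.

Lemma is_derive_scale (W : normedModType R) (a : R^o -> R^o) (f : R^o -> W) t v :
  derivable a t v -> derivable f t v ->
  is_derive t v (fun s => a s *: f s) (a t *: 'D_v f t + 'D_v a t *: f t).
Proof.
move=> da df.
suff H : (fun h => h^-1 *: (((fun s => a s *: f s) \o shift t) (h *: v) - a t *: f t))
    @ 0^' --> a t *: 'D_v f t + 'D_v a t *: f t.
  by split; [apply/cvg_ex; eexists; exact: H|apply: cvg_lim H].
rewrite (_ : (fun h => _) = (fun h : R => a (h *: v + t) *: (h^-1 *: (f (h *: v + t) - f t))
    + (h^-1 * (a (h *: v + t) - a t)) *: f t)); last first.
  apply/funext => h /=; rewrite scalerA (mulrC (a _)) -!scalerA -scalerDr.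
  by congr (_ *: _); rewrite scalerBl scalerBr addrA subrK.
apply: cvgD; last exact: cvgZr_tmp da.
apply: cvgZ; last exact: df.
suff : {for 0, continuous (fun h : R => a (h *: v + t))}.
  by move=> /continuous_withinNx; rewrite scale0r add0r.
exact/differentiable_continuous/derivable1_diffP/(derivable1P _ _ _).1.
Qed.

Lemma Ck_scale (W : normedModType R) k (U : set R^o) (a : R^o -> R^o) (f : R^o -> W) :
  open U -> Ck_on k U a -> Ck_on k U f -> Ck_on k U (fun t => a t *: f t).
Proof.
move=> oU; elim: k a f => [|k IH] a f /=.
  by move=> ca cf x Ux; apply: cvgZ; [exact: ca|exact: cf].
move=> Ca Cf; have [da dda] := Ca; have [df ddf] := Cf; split=> [x Ux|v].
  apply/derivable1_diffP.
  have H := @is_derive_scale _ a f x 1 (diff_derivable (da _ Ux)) (diff_derivable (df _ Ux)).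
  exact: ex_derive.
apply: (Ck_congr (g := fun t => a t *: 'D_v f t + 'D_v a t *: f t)) => // [x Ux|].
  have H := @is_derive_scale _ a f x v (diff_derivable (da _ Ux)) (diff_derivable (df _ Ux)).
  exact: derive_val.
by apply: Ck_add => //; apply: IH => //; apply: Ck_weaken.
Qed.

Lemma is_derive_comp_line (W : normedModType R) (f : R^o -> W) (s : R^o -> R^o) t v :
  derivable f (s t) 1 -> derivable s t 1 ->
  is_derive t v (f \o s) ('D_v s t *: 'D_1 f (s t)).
Proof.
move=> /derivable1_diffP df /derivable1_diffP ds.
have dfs := differentiable_comp ds df.
split; first exact: diff_derivable.
rewrite deriveE// diff_comp//= deriveE// deriveE//.
by rewrite -[in LHS](mulr1 ('d s t v)) -[_ * 1]/(_ *: (1 : R^o)) linearZ.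
Qed.

(** By induction on the order, since the derivative of [f \o s] is the
product of the derivative of [s] and of ['D_1 f \o s]. *)
Lemma Ck_comp (W : normedModType R) k (U B : set R^o) (f : R^o -> W) (s : R^o -> R^o) :
  open U -> (forall t, U t -> B (s t)) -> Ck_on k B f -> Ck_on k U s ->
  Ck_on k U (f \o s).
Proof.
move=> oU UO; elim: k f => [|k IH] f /=.
  move=> cf cs t Ut; apply: continuous_comp; first exact: cs.
  by apply: cf; exact: UO.
move=> [df ddf] Cs; have [ds dds] := Cs; split=> [t Ut|v].
  by apply: differentiable_comp; [exact: ds|apply/df/UO].
apply: (Ck_congr (g := fun t => 'D_v s t *: ('D_1 f \o s) t)) => // [t Ut|].
  have H : is_derive t v (f \o s) ('D_v s t *: 'D_1 f (s t)).
    by apply: is_derive_comp_line; apply: diff_derivable; [apply/df/UO|apply: ds].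
  exact: derive_val.
by apply: Ck_scale => //; apply: IH => //; apply: (Ck_weaken Cs).
Qed.

Lemma is_derive_line (V W : normedModType R) (f : V -> W) (x v : V) (t h : R^o) :
  differentiable f (x + t *: v) ->
  is_derive t h (fun s : R^o => f (x + s *: v)) ('D_(h *: v) f (x + t *: v)).
Proof.
move=> df.
have H : (fun h' : R^o => h'^-1 *: (f (x + (h' *: h + t) *: v) - f (x + t *: v)))
    @ 0^' --> 'D_(h *: v) f (x + t *: v).
  rewrite (_ : (fun h' => _) = (fun h' : R =>
      h'^-1 *: ((f \o shift (x + t *: v)) (h' *: (h *: v)) - f (x + t *: v)))).
    exact: (diff_derivable df).
  apply/funext => k /=; congr (_ *: (f _ - _)).
  by rewrite scalerDl addrCA scalerA.
split; first by apply/cvg_ex; eexists; exact: H.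
by apply: cvg_lim H.
Qed.

(** Restricting to an affine line turns ['D_h] into the directional derivative
['D_(h *: v)], which is again of the form covered by the induction hypothesis. *)
Lemma Ck_line (V W : normedModType R) k (B : set V) (f : V -> W) (x v : V) :
  open B -> Ck_on k B f ->
  Ck_on k [set t : R^o | B (x + t *: v)] (fun t : R^o => f (x + t *: v)).
Proof.
move=> oB.
have cl : continuous (fun t : R^o => x + t *: v).
  by move=> t; apply: cvgD; [exact: cvg_cst|apply: cvgZr_tmp].
have oU : open [set t : R^o | B (x + t *: v)] by apply: open_comp => // t _; exact: cl.
elim: k f => [|k IH] f /=.
  move=> cf t Ot; apply: (@continuous_comp _ _ _ (fun t : R^o => x + t *: v) f).
    exact: cl.
  exact: cf.
move=> [df ddf]; split=> [t Ot|h].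
  apply/derivable1_diffP.
  by have H := @is_derive_line _ _ f x v t 1 (df _ Ot); apply: ex_derive.
apply: (Ck_congr (g := fun t => 'D_(h *: v) f (x + t *: v))) => // [t Ot|].
  by have H := @is_derive_line _ _ f x v t h (df _ Ot); apply: derive_val.
by apply: (IH ('D_(h *: v) f)); exact: ddf.
Qed.

Lemma Ck_opp k (U : set R^o) : Ck_on k U (-%R : R^o -> R^o).
Proof.
have -> : (-%R : R^o -> R^o) = fun t : R^o => id (0 + t *: (-1 : R^o)).
  by apply/funext => t; rewrite add0r [_ *: _]mulrN1.
by apply: Ck_subset (@Ck_line R^o R^o k setT id 0 (-1 : R^o) openT _) => //; exact: Ck_id.
Qed.

End CkLine.

(** * Smooth functions that are flat at the origin *)

Section Flat.
Context {R : realType}.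

(** The functions P(1/t) exp(-1/t), extended by 0.  Allowing a polynomial factor
makes the family stable under differentiation. *)
Definition flat (p : {poly R}) (t : R^o) : R^o :=
  if 0 < t then p.[t^-1] * expR (- t^-1) else 0.

(** Each monomial y^n is at most n! exp y. *)
Lemma horner_le_expR (p : {poly R}) :
  exists2 K : R, 0 <= K & forall y, 0 <= y -> `|p.[y]| <= K * expR y.
Proof.
exists (\sum_(i < size p) `|p`_i| * i`!%:R) => [|y y0].
  by apply: sumr_ge0 => i _; rewrite mulr_ge0.
rewrite horner_coef mulr_suml (le_trans (ler_norm_sum _ _ _))//.
apply: ler_sum => i _; rewrite normrM normrX (ger0_norm y0) -mulrA ler_wpM2l//.
case: (nat_of_ord i) => [|n].
  by rewrite expr0 fact0 mul1r -expR0 ler_expR.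
rewrite mulrC -ler_pdivrMr ?ltr0n ?fact_gt0//.
by rewrite (le_trans _ (expR_ge1Dxn n y0))// lerDr.
Qed.

(** Flatness at 0, to the order that makes the derivative at 0 vanish. *)
Lemma flat_le_sqr (p : {poly R}) :
  exists2 K : R, 0 <= K & forall t, `|flat p t| <= K * t ^+ 2.
Proof.
have [K K0 HK] := horner_le_expR (p * 'X^2); exists K => // t.
rewrite /flat; case: ifPn => [t0|_]; last by rewrite normr0 mulr_ge0 ?sqr_ge0.
have ti0 : 0 < t^-1 by rewrite invr_gt0.
have := HK _ (ltW ti0); rewrite hornerM hornerXn [in X in X -> _]normrM normrX (gtr0_norm ti0).
rewrite normrM (gtr0_norm (expR_gt0 _)) expRN -ler_pdivrMr ?expR_gt0//.
by rewrite mulrAC exprVn ler_pdivrMr ?exprn_gt0.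
Qed.

(** With y = 1/t one has dy/dt = - y^2, and (P(y) exp(-y))' = (P'(y) - P(y)) exp(-y). *)
Lemma is_derive_flat (p : {poly R}) (t : R^o) :
  is_derive t 1 (flat p) (flat ('X^2 * (p - p^`())) t).
Proof.
have [t0|t0|t0] := ltgtP t 0.
- rewrite [X in is_derive _ _ _ X](_ : _ = 0); last first.
    by rewrite /flat ltNge (ltW t0).
  apply: (@near_eq_is_derive _ R^o R^o (fun=> 0)).
  near=> s; rewrite /flat ifF//; apply/negbTE; rewrite -leNgt ltW//.
  by near: s; apply: lt_nbhsl.
- rewrite [X in is_derive _ _ _ X]/flat t0.
  apply: (@near_eq_is_derive _ _ _ ((fun y : R => p.[y] * expR (- y)) \o GRing.inv)).
    near=> s; rewrite /flat /= ifT//.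
    by near: s; apply: lt_nbhsr.
  have t00 : t != 0 by rewrite gt_eqF.
  have H1 : is_derive t 1 (@GRing.inv R) (- t ^- 2).
    have := @is_deriveV _ id t 1 1 t00 (is_derive_id _ _).
    by rewrite /= [_ *: _]mulr1.
  have H2 : is_derive t^-1 1 (horner p) (p^`()).[t^-1].
    split; first exact: derivable_horner.
    by rewrite -derive1E -derivE.
  have H3 : is_derive t^-1 1 (fun y : R => expR (- y)) (- expR (- t^-1)).
    have := @is_derive1_comp _ expR (@GRing.opp R) t^-1 _ (-1) (is_derive_expR _) _.
    by rewrite mulrN1; apply; exact: is_deriveNid.
  have := @is_derive1_comp _ _ _ t _ _ (@is_deriveM _ _ _ _ _ _ _ _ H2 H3) H1.
  rewrite (_ : _ * _ = ('X^2 * (p - p^`())).[t^-1] * expR (- t^-1)) //.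
  rewrite !hornerE /= /GRing.scale/=; move: (expR _) => e.
  by rewrite -exprVn; ring.
- rewrite t0 [X in is_derive _ _ _ X]/flat ltxx.
  suff H : (fun h : R => h^-1 *: ((flat p \o shift 0) (h *: 1) - flat p 0)) @ 0^' --> (0 : R).
    by split; [apply/cvg_ex; exists 0; exact: H|apply: cvg_lim H].
  have [K K0 HK] := flat_le_sqr p.
  apply/cvgrPdist_le => e e0; near=> h.
  have hn0 : h != 0 by near: h; exact: nbhs_dnbhs_neq.
  rewrite {2}/flat ltxx subr0 sub0r normrN /= addr0 [h *: 1]mulr1.
  rewrite [_ *: _]/(_ * _) normrM normfV ler_pdivrMl ?normr_gt0//.
  rewrite (le_trans (HK _))// -real_normK ?num_real// expr2 mulrCA ler_wpM2l//.
  rewrite (@le_trans _ _ ((K + 1) * `|h|))//; first by rewrite ler_wpM2r// lerDl.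
  rewrite -ler_pdivlMl ?ltr_wpDl//; near: h; apply: dnbhs0_le.
  by rewrite mulr_gt0// invr_gt0 ltr_wpDl.
Unshelve. all: by end_near. Qed.

(** All the derivatives stay in the family, so differentiability suffices. *)
Lemma flat_smooth (p : {poly R}) k : Ck_on k setT (flat p).
Proof.
elim: k p => [|k IH] p /=.
  move=> x _; apply/differentiable_continuous/derivable1_diffP.
  by have H := is_derive_flat p x; apply: ex_derive.
split=> [x _|v].
  by apply/derivable1_diffP; have H := is_derive_flat p x; apply: ex_derive.
apply: (Ck_congr openT (g := flat ('X^2 * (p - p^`()) * v%:P))) => // x _.
have H := is_derive_flat p x.
have /derivable1_diffP df : derivable (flat p) x 1 by apply: ex_derive.
rewrite deriveE// -[v in LHS]mulr1 -[_ * 1]/(v *: (1 : R^o)) linearZ/= -deriveE//.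
rewrite derive_val /flat; case: ifP => _; last exact: scaler0.
by rewrite [in RHS]hornerM [in RHS]hornerC [LHS]mulrCA mulrA.
Qed.

End Flat.

(** * Row vectors and bilinear forms depending on a point *)

Lemma continuous_norm_sub (R : realType) (V : normedModType R) (x0 : V) :
  continuous (fun x => `|x - x0|).
Proof. by move=> x; apply: cvg_norm; apply: cvgB; [exact: cvg_id|exact: cvg_cst]. Qed.

Section RowNorm.
Context {R : realType} {m : nat}.
Implicit Types x y w : 'rV[R]_m.

Lemma coord_norm_le x k : `|x 0 k| <= `|x|.
Proof.
rewrite [leRHS]/Num.Def.normr/= mx_normrE.
exact: (le_bigmax _ (fun ij : 'I_1 * 'I_m => `|x ij.1 ij.2|) (0, k)).
Qed.

Lemma norm_le_coord x e : 0 <= e -> (forall k, `|x 0 k| <= e) -> `|x| <= e.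
Proof.
move=> e0 H; rewrite [leLHS]/Num.Def.normr/= mx_normrE; apply: bigmax_le => //=.
by move=> [i k] _ /=; rewrite ord1.
Qed.

Lemma compact_row_ball x0 r : compact [set x | `|x - x0| <= r].
Proof.
apply: bounded_closed_compact; last first.
  have := @closed_closed_ball_ R 'rV[R]_m x0 r; congr closed.
  by apply/seteqP; split => x; rewrite /closed_ball_/= distrC.
exists (r + `|x0|); split; first exact: num_real.
move=> M rM x /= xr; rewrite -(subrK x0 x) (le_trans (ler_normD _ _))//.
by rewrite (le_trans _ (ltW rM))// lerD2r.
Qed.

(** The norm of ['rV[R]_m] is the maximum norm; estimates for it therefore hold
for the Euclidean distance as well. *)
Lemma norm_le_euclidean x y : `|x - y| <= euclidean_dist x y.
Proof.
apply: norm_le_coord => [|k]; first exact: sqrtr_ge0.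
rewrite !mxE -sqrtr_sqr ler_wsqrtr// (bigD1 k)//= lerDl.
by apply: sumr_ge0 => i _; exact: sqr_ge0.
Qed.

End RowNorm.

Lemma sum_dist_cvg0 (R : realType) (m : nat) (T : topologicalType)
    (G : 'I_m -> 'I_m -> T -> R^o) (t : T) :
  (forall k l, {for t, continuous (G k l)}) ->
  (\sum_k \sum_l `|G k l s - G k l t| : R^o) @[s --> t] --> (0 : R^o).
Proof.
move=> cG; pose D s : R^o := \sum_k \sum_l `|G k l s - G k l t|.
have D0 : D t = 0.
  by rewrite /D big1// => k _; rewrite big1// => l _; rewrite subrr normr0.
rewrite -[X in _ --> X]D0 /D; apply: cvg_big => [|k _]; first exact: add_continuous.
apply: cvg_big => [|l _]; first exact: add_continuous.
by apply: cvg_norm; apply: cvgB; [exact: cG|exact: cvg_cst].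
Qed.

(** The metric tensor as seen in a chart: [E] is the image of the chart, and [x]
its coordinates. *)
Section VaryingForm.
Context {R : realType} {m : nat}.
Variables (E : set 'rV[R]_m) (B : 'rV[R]_m -> 'rV[R]_m -> 'rV[R]_m -> R).
Hypothesis E_open : open E.
Hypothesis B_linear : forall x a u v w, E x ->
  B x (a *: u + v) w = a * B x u w + B x v w.
Hypothesis B_sym : forall x u v, E x -> B x u v = B x v u.
Hypothesis B_pos : forall x w, E x -> w != 0 -> 0 < B x w w.
Hypothesis B_continuous : forall u v x, E x -> {for x, continuous (fun x => B x u v : R^o)}.

Lemma form0l x w : E x -> B x 0 w = 0.
Proof.
by move=> Ex; rewrite -(subrr w) addrC -scaleN1r B_linear// mulN1r addNr.
Qed.

Lemma form_scale x a w : E x -> B x (a *: w) (a *: w) = a ^+ 2 * B x w w.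
Proof.
move=> Ex; have H u v : B x (a *: u) v = a * B x u v.
  by rewrite -[a *: u]addr0 B_linear// form0l// addr0.
by rewrite H B_sym// H mulrA expr2.
Qed.

(** The joint continuity of [B x w w] in [x] and [w] is read off this expansion. *)
Lemma form_row x u v : E x ->
  B x u v = \sum_k \sum_l u 0 k * v 0 l * B x (delta_mx 0 k) (delta_mx 0 l).
Proof.
move=> Ex.
have H (s : 'rV[R]_m) w : B x s w = \sum_k s 0 k * B x (delta_mx 0 k) w.
  have HD a b : B x (a + b) w = B x a w + B x b w.
    by rewrite -[a]scale1r B_linear// mul1r scale1r.
  rewrite [in LHS](row_sum_delta s) (big_morph (fun s => B x s w) HD (form0l w Ex)).
  apply: eq_bigr => k _.
  by rewrite -[_ *: _ in LHS]addr0 B_linear// form0l// addr0.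
rewrite H; apply: eq_bigr => k _; rewrite B_sym// H mulr_sumr; apply: eq_bigr => l _.
by rewrite mulrA B_sym.
Qed.

Lemma form_continuous_comp (T : topologicalType) (X w : T -> 'rV[R]_m) (t : T) :
  E (X t) -> {for t, continuous X} -> {for t, continuous w} ->
  {for t, continuous (fun s => B (X s) (w s) (w s) : R^o)}.
Proof.
move=> Et cX cw.
pose F s : R^o := \sum_k \sum_l w s 0 k * w s 0 l * B (X s) (delta_mx 0 k) (delta_mx 0 l).
suff cF : F s @[s --> t] --> F t.
  rewrite /prop_for /continuous_at [X in _ --> X](form_row _ _ Et) -/(F t).
  apply: cvg_trans cF; apply: near_eq_cvg.
  have : \forall s \near t, E (X s) by apply: cX; exact: open_nbhs_nbhs.
  by apply: filterS => s Es; rewrite (form_row (w s) (w s) Es).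
have cc k : w s 0 k @[s --> t] --> w t 0 k.
  exact: (cvg_comp _ _ cw (@matrix_normedtype.coord_continuous R 1 m 0 k (w t))).
rewrite /F; apply: cvg_big => [|k _]; first exact: add_continuous.
apply: cvg_big => [|l _]; first exact: add_continuous.
apply: cvgM; first by apply: cvgM; exact: cc.
exact: (cvg_comp _ _ cX (@B_continuous _ _ _ Et)).
Qed.

(** The minimum of the form on the compact unit sphere.  For m = 0 the sphere is
empty and any constant will do. *)
Lemma form_pos_lower x : E x -> exists2 mu, 0 < mu & forall w, mu * `|w| ^+ 2 <= B x w w.
Proof.
move=> Ex.
have normalize (w : 'rV[R]_m) : w != 0 -> `| (`|w|^-1 *: w) | = 1.
  by move=> w0; rewrite normrZ normfV normr_id mulVf// normr_eq0.
have [S0|/set0P S0] := eqVneq [set w : 'rV[R]_m | `|w| = 1] set0.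
  exists 1 => // w; have [->|w0] := eqVneq w 0.
    by rewrite normr0 expr0n mulr0 form0l.
  exfalso; suff : (set0 : set 'rV[R]_m) (`|w|^-1 *: w) by [].
  by rewrite -S0; exact: normalize.
have cS : compact [set w : 'rV[R]_m | `|w| = 1].
  have cB := @compact_row_ball R m 0 1.
  apply: (subclosed_compact _ cB) => [|w /= w1]; last first.
    by rewrite subr0 w1.
  rewrite [X in closed X](_ : _ = (fun w : 'rV[R]_m => `|w|) @^-1` [set 1])//.
  by apply: closed_comp => // w _; exact: norm_continuous.
have [|c /set_mem/= c1 cmin] := @compact_EVT_min _ R (fun w => B x w w) _ S0 cS.
  apply: continuous_subspaceT => w.
  apply: (@form_continuous_comp _ (fun=> x) id w Ex); last exact: cvg_id.
  exact: (@cst_continuous _ _ x w).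
exists (B x c c) => [|w].
  by apply: B_pos => //; rewrite -normr_eq0 c1 oner_eq0.
have [->|w0] := eqVneq w 0; first by rewrite normr0 expr0n mulr0 form0l.
have := cmin (`|w|^-1 *: w); rewrite inE => /(_ (normalize w w0)).
by rewrite form_scale// exprVn mulrC ler_pdivlMr ?exprn_gt0 ?normr_gt0.
Qed.

(** By the expansion in coordinates, [B x w w] differs from [B x0 w w] by at most
the sum of the variations of the coefficients times the square of the norm of
[w]; near [x0] this is at most half of the lower bound at [x0]. *)
Lemma form_local_bounds x0 : E x0 -> exists s kappa C, [/\ 0 < s, 0 < kappa, 0 < C,
  (forall x, `|x - x0| < s -> E x) &
  (forall x w, `|x - x0| < s ->
     kappa ^+ 2 * `|w| ^+ 2 <= B x w w <= C ^+ 2 * `|w| ^+ 2)].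
Proof.
move=> Ex0; have [mu mu0 Hmu] := form_pos_lower Ex0.
pose G x k l := B x (delta_mx 0 k) (delta_mx 0 l).
pose D x : R^o := \sum_k \sum_l `|G x k l - G x0 k l|.
have cD : D x @[x --> x0] --> (0 : R).
  by apply: sum_dist_cvg0 => k l; exact: B_continuous.
have HD x w : E x -> `|B x w w - B x0 w w| <= D x * `|w| ^+ 2.
  move=> Ex; rewrite (form_row w w Ex) (form_row w w Ex0) -sumrB mulr_suml.
  rewrite (le_trans (ler_norm_sum _ _ _))//; apply: ler_sum => k _.
  rewrite -sumrB mulr_suml (le_trans (ler_norm_sum _ _ _))//; apply: ler_sum => l _.
  rewrite -mulrBr normrM mulrC ler_wpM2l// normrM expr2.
  by apply: ler_pM => //; exact: coord_norm_le.
pose K := \sum_k \sum_l `|G x0 k l|.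
have K0 : 0 <= K by apply: sumr_ge0 => k _; apply: sumr_ge0.
have HK w : B x0 w w <= K * `|w| ^+ 2.
  rewrite (form_row w w Ex0) mulr_suml; apply: ler_sum => k _.
  rewrite mulr_suml; apply: ler_sum => l _.
  rewrite (le_trans (ler_norm _))// normrM mulrC ler_wpM2l// normrM expr2.
  by apply: ler_pM => //; exact: coord_norm_le.
have : \forall x \near x0, E x /\ `|D x| < mu / 2.
  near=> x; split; near: x; first exact: open_nbhs_nbhs.
  by move/cvgr0_norm_lt : cD; apply; rewrite divr_gt0.
move=> /nbhs_normP[s /= s0 Hs].
have {}Hs x : `|x - x0| < s -> E x /\ `|D x| < mu / 2.
  by move=> xs; apply: Hs; rewrite /ball_ /= distrC.
have sq2 (a : R) : 0 < a -> Num.sqrt a ^+ 2 = a by move=> a0; rewrite sqr_sqrtr// ltW.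
exists s, (Num.sqrt (mu / 2)), (Num.sqrt (K + mu)); split=> //.
- by rewrite sqrtr_gt0 divr_gt0.
- by rewrite sqrtr_gt0 ltr_wpDl.
- by move=> x /Hs[].
move=> x w /Hs[Ex Dx]; rewrite !sq2 ?divr_gt0 ?ltr_wpDl//.
have := HD x w Ex; have := Hmu w; have := HK w.
have : D x * `|w| ^+ 2 <= mu / 2 * `|w| ^+ 2.
  by rewrite ler_wpM2r ?sqr_ge0// (le_trans (ler_norm _))// ltW.
have : 0 <= mu * `|w| ^+ 2 by rewrite mulr_ge0 ?sqr_ge0// ltW.
move: (B x w w) (B x0 w w) (`|w| ^+ 2) (D x) => b b0 W d.
move=> h1 h2 h3 h4; rewrite ler_norml => /andP[h5 h6].
by apply/andP; split; lra.
Unshelve. all: by end_near. Qed.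

End VaryingForm.

(** * The metric tensor in a chart *)

Section Charts.
Context {R : realType} {m : nat} {M : topologicalType}.
Variable A : smooth_manifold R m M.
Implicit Types (i j k : chart A) (p : M).

Lemma dom_nbhs i p : dom i p -> nbhs p (dom i).
Proof. by move=> ip; apply: open_nbhs_nbhs; split => //; exact: dom_open. Qed.

Lemma chart_image_param i x : (coord i @` dom i) x ->
  dom i (param i x) /\ coord i (param i x) = x.
Proof. by move=> [p ip <-]; rewrite coordK. Qed.

Lemma near_chart_image i j p : dom i p -> dom j p ->
  \forall x \near coord i p, (coord i @` dom i) x /\ dom j (param i x).
Proof.
move=> ip jp; have Ip : (coord i @` dom i) (coord i p) by exists p.
apply: filterI.
  by apply: open_nbhs_nbhs; split => //; exact: coord_dom_open.
by apply: (param_continuous Ip); rewrite coordK//; exact: dom_nbhs.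
Qed.

Lemma transition_differentiable i j p : dom i p -> dom j p ->
  differentiable (coord j \o param i) (coord i p).
Proof.
by move=> ip jp; have [H _] := transition_smooth i j 1%N; apply: H; exists p.
Qed.

Lemma coord_vectorE i w p j : dom j p ->
  coord_vector i w p j = 'D_w (coord j \o param i) (coord i p).
Proof. by move=> jp; rewrite /coord_vector mem_set. Qed.

Lemma coord_vector_out i w p j : ~ dom j p -> coord_vector i w p j = 0.
Proof. by move=> jp; rewrite /coord_vector memNset. Qed.

Lemma coord_vector_id i w p : dom i p -> coord_vector i w p i = w.
Proof.
move=> ip; rewrite coord_vectorE// -[RHS](derive_id (coord i p) w).
apply: near_eq_derive; apply: filterS (near_chart_image ip ip) => x [].
by move=> /chart_image_param[].
Qed.

Lemma coord_vector_linear i p a u v : dom i p ->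
  coord_vector i (a *: u + v) p = a *: coord_vector i u p + coord_vector i v p.
Proof.
move=> ip; apply/funext => j; rewrite fctE/= /GRing.scale/=.
have [jp|jp] := pselect (dom j p); last first.
  by rewrite !coord_vector_out// scaler0 addr0.
have d := transition_differentiable ip jp.
by rewrite !coord_vectorE// !deriveE// linearP.
Qed.

(** The chain rule for transition maps. *)
Lemma coord_vector_tangent i p w : dom i p -> tangent p (coord_vector i w p).
Proof.
move=> ip; split=> [j k jp kp|j jp]; last exact: coord_vector_out.
rewrite (coord_vectorE _ _ kp) (coord_vectorE _ _ jp).
have dij := transition_differentiable ip jp.
have djk := transition_differentiable jp kp.
have E : (coord j \o param i) (coord i p) = coord j p by rewrite /= coordK.
have dk' : differentiable (coord k \o param j) ((coord j \o param i) (coord i p)).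
  by rewrite E.
rewrite -E (deriveE _ dk') (deriveE _ dij).
rewrite -[RHS]/(('d (coord k \o param j) ((coord j \o param i) (coord i p))
   \o 'd (coord j \o param i) (coord i p)) w) -diff_comp//.
rewrite -(deriveE _ (differentiable_comp dij dk')).
apply: near_eq_derive; apply: filterS (near_chart_image ip jp) => x [_ jx] /=.
by rewrite coordK.
Qed.

(** All components of the velocity are determined by the one in a single chart,
again by the chain rule. *)
Lemma velocity_coord_vector i (c : R -> M) (t : R) :
  {for t, continuous c} -> dom i (c t) ->
  differentiable (coord i \o c : R^o -> 'rV[R]_m) t ->
  velocity c t = coord_vector i ('D_1 (coord i \o c : R^o -> 'rV[R]_m) t) (c t).
Proof.
move=> cc it dc; apply/funext => j; rewrite /velocity.
have [jt|jt] := pselect (dom j (c t)); last by rewrite memNset// coord_vector_out.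
rewrite mem_set// (coord_vectorE _ _ jt).
have d : differentiable (coord j \o param i) ((coord i \o c) t).
  exact: transition_differentiable.
rewrite [RHS](deriveE _ d) (deriveE _ dc).
rewrite -[RHS]/(('d (coord j \o param i) ((coord i \o c) t)
   \o 'd (coord i \o c : R^o -> 'rV[R]_m) t) 1) -diff_comp//.
rewrite -(deriveE _ (differentiable_comp dc d)).
apply: near_eq_derive.
have : \forall s \near t, dom i (c s) by apply: cc; exact: dom_nbhs.
by apply: filterS => s /= si; rewrite coordK.
Qed.

Variable g : riemannian_metric A.

Definition chart_metric i x u v : R :=
  g (param i x) (coord_vector i u (param i x)) (coord_vector i v (param i x)).

Lemma chart_metric_linear i x a u v w : (coord i @` dom i) x ->
  chart_metric i x (a *: u + v) w = a * chart_metric i x u w + chart_metric i x v w.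
Proof.
move=> /chart_image_param[ix _]; rewrite /chart_metric coord_vector_linear//.
by apply: metric_linear; exact: coord_vector_tangent.
Qed.

Lemma chart_metric_sym i x u v : (coord i @` dom i) x ->
  chart_metric i x u v = chart_metric i x v u.
Proof.
move=> /chart_image_param[ix _].
by apply: metric_sym; exact: coord_vector_tangent.
Qed.

Lemma chart_metric_pos i x w : (coord i @` dom i) x -> w != 0 ->
  0 < chart_metric i x w w.
Proof.
move=> /chart_image_param[ix _] w0.
apply: metric_pos; first exact: coord_vector_tangent.
apply: contra_neq w0 => /(congr1 (fun v => v i)).
by rewrite coord_vector_id.
Qed.

Lemma chart_metric_continuous i u v x : (coord i @` dom i) x ->
  {for x, continuous (fun x => chart_metric i x u v : R^o)}.
Proof. exact: (metric_smooth g i u v 0%N). Qed.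

Definition speed (c : R -> M) (t : R) : R :=
  Num.sqrt (g (c t) (@velocity _ _ _ A c t) (@velocity _ _ _ A c t)).

Lemma speed_chart i (c : R -> M) (t : R) :
  {for t, continuous c} -> dom i (c t) ->
  differentiable (coord i \o c : R^o -> 'rV[R]_m) t ->
  let w := 'D_1 (coord i \o c : R^o -> 'rV[R]_m) t in
  speed c t = Num.sqrt (chart_metric i (coord i (c t)) w w).
Proof.
by move=> cc ic dc w; rewrite /speed /chart_metric (coordK ic) (velocity_coord_vector cc ic dc).
Qed.

Lemma chart_metric_scale i x a w : (coord i @` dom i) x ->
  chart_metric i x (a *: w) (a *: w) = a ^+ 2 * chart_metric i x w w.
Proof.
move=> ix; apply: (@form_scale _ _ (coord i @` dom i) (chart_metric i) _ _ x a w ix).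
  by move=> *; exact: chart_metric_linear.
by move=> *; exact: chart_metric_sym.
Qed.

(** The comparison of the Riemannian norm with the coordinate norm, uniform on a
coordinate ball: [C] bounds the lengths of segments from above, [kappa] the
lengths of all curves from below. *)
Lemma chart_metric_bounds i x0 : (coord i @` dom i) x0 ->
  exists s kappa C, [/\ 0 < s, 0 < kappa, 0 < C,
  (forall x, `|x - x0| < s -> (coord i @` dom i) x) &
  (forall x w, `|x - x0| < s ->
     kappa * `|w| <= Num.sqrt (chart_metric i x w w) <= C * `|w|)].
Proof.
move=> ix0.
have [] := @form_local_bounds _ _ (coord i @` dom i) (chart_metric i) _ _ _ _ _ x0 ix0.
- exact: coord_dom_open.
- by move=> *; exact: chart_metric_linear.
- by move=> *; exact: chart_metric_sym.
- by move=> *; exact: chart_metric_pos.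
- by move=> *; exact: chart_metric_continuous.
move=> s [kappa [C [s0 k0 C0 sI H]]].
exists s, kappa, C; split=> // x w xs; have /andP[H1 H2] := H x w xs.
have sq (a : R) : 0 < a -> a * `|w| = Num.sqrt (a ^+ 2 * `|w| ^+ 2).
  by move=> a0; rewrite -exprMn sqrtr_sqr ger0_norm// mulr_ge0// ltW.
by rewrite !sq// !ler_wsqrtr.
Qed.

End Charts.

(** * Speed and arc length of smooth curves *)

Section ArcLength.
Context {R : realType} {m : nat} {M : topologicalType}.
Variables (A : smooth_manifold R m M) (g : riemannian_metric A).
Implicit Types (i j : chart A) (c : R -> M) (U : set R).

(** Smoothness on an open set of parameters.  Unlike [smooth_curve] it is stable
under gluing and reparametrization without reference to end points. *)
Definition smooth_path U c : Prop :=
  [/\ open U, forall t, U t -> {for t, continuous c} &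
    forall i : chart A, smooth_on (U `&` c @^-1` dom i : set R^o)
      (coord i \o c : R^o -> 'rV[R]_m)].

Lemma smooth_curveP (a b : R) c :
  smooth_curve A a b c <-> exists2 U, smooth_path U c & `[a, b] `<=` U.
Proof.
by split=> [[U [oU abU cc sc]]|[U [oU cc sc] abU]]; exists U.
Qed.

Lemma preimage_dom_open U c i : open U -> (forall t, U t -> {for t, continuous c}) ->
  open (U `&` c @^-1` dom i).
Proof.
move=> oU cc; rewrite openE => t [Ut it].
apply: filterI; first exact: open_nbhs_nbhs.
by apply: cc => //; exact: dom_nbhs.
Qed.

Lemma smooth_path_open U c i : smooth_path U c -> open (U `&` c @^-1` dom i).
Proof. by move=> [oU cc _]; exact: preimage_dom_open. Qed.

Lemma smooth_path_differentiable U c i t : smooth_path U c -> U t -> dom i (c t) ->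
  differentiable (coord i \o c : R^o -> 'rV[R]_m) t.
Proof. by move=> [_ _ sc] Ut it; have [H _] := sc i 1%N; apply: H. Qed.

Lemma speed_ge0 c t : 0 <= speed g c t.
Proof. exact: sqrtr_ge0. Qed.

Lemma smooth_path_speed U c i t : smooth_path U c -> U t -> dom i (c t) ->
  let w := 'D_1 (coord i \o c : R^o -> 'rV[R]_m) t in
  speed g c t = Num.sqrt (chart_metric g i (coord i (c t)) w w).
Proof.
move=> sc Ut it; have [_ cc _] := sc; apply: speed_chart => //; first exact: cc.
exact: smooth_path_differentiable sc Ut it.
Qed.

(** In a chart the speed is a continuous function of the position and the
coordinate velocity. *)
Lemma speed_continuous U c t : smooth_path U c -> U t ->
  {for t, continuous (speed g c)}.
Proof.
move=> sc Ut; have [_ cc smc] := sc; have [i it] := dom_cover A (c t).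
pose w s := 'D_1 (coord i \o c : R^o -> 'rV[R]_m) s.
have cw : {for t, continuous w} by have [_ /(_ 1)[H _]] := smc i 2%N; apply: differentiable_continuous; apply: H.
have cX : {for t, continuous (coord i \o c)}.
  apply: continuous_comp; first exact: cc.
  exact: coord_continuous.
have cQ : {for t, continuous (fun s => chart_metric g i (coord i (c s)) (w s) (w s) : R^o)}.
  apply: (@form_continuous_comp _ _ (coord i @` dom i) (chart_metric g i) _ _ _ _ _
    (coord i \o c) w t _ cX cw).
  - exact: coord_dom_open.
  - by move=> *; exact: chart_metric_linear.
  - by move=> *; exact: chart_metric_sym.
  - by move=> *; exact: chart_metric_continuous.
  - by exists (c t).
have cS : {for t, continuous (fun s => Num.sqrt (chart_metric g i (coord i (c s)) (w s) (w s)))}.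
  exact: (cvg_comp _ _ cQ (@sqrt_continuous _ _)).
suff : speed g c @ t --> Num.sqrt (chart_metric g i (coord i (c t)) (w t) (w t)).
  by rewrite -(smooth_path_speed sc Ut it).
apply: cvg_trans cS; apply: near_eq_cvg.
have : \forall s \near t, (U `&` c @^-1` dom i) s.
  by apply: open_nbhs_nbhs; split => //; exact: smooth_path_open.
by apply: filterS => s [Us si]; rewrite (smooth_path_speed sc Us si).
Qed.

(** The derivative is two-sided also at the end points, which makes sense because
smooth curves are defined beyond them; it makes antiderivatives composable. *)
Definition arc_length_function (a b : R) c (l : R -> R) : Prop :=
  forall t, a <= t <= b -> is_derive t 1 l (speed g c t).

(** Room on both sides of the parameter interval, needed to differentiate an
integral at its end points. *)
Lemma open_segment_enlarge (a b : R) U : a <= b -> open U -> `[a, b] `<=` U ->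
  exists a' b', [/\ a' < a, b < b' & `[a', b'] `<=` U].
Proof.
move=> ab oU abU.
have : nbhs a U by apply: open_nbhs_nbhs; split => //; apply: abU; rewrite /= in_itv/= lexx.
move=> /nbhs_normP[e /= e0 eU].
have : nbhs b U by apply: open_nbhs_nbhs; split => //; apply: abU; rewrite /= in_itv/= lexx ab.
move=> /nbhs_normP[f /= f0 fU].
exists (a - e / 2), (b + f / 2); split.
- by rewrite ltrBlDr ltrDl divr_gt0.
- by rewrite ltrDl divr_gt0.
move=> t /=; rewrite in_itv/= => /andP[at_ tb].
have [ta|ta] := ltP t a.
  by apply: eU; rewrite /= ger0_norm; lra.
have [bt|bt] := ltP b t.
  by apply: fU; rewrite /= distrC ger0_norm; lra.
by apply: abU; rewrite /= in_itv/= ta bt.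
Qed.

Lemma arc_length_function_exists (a b : R) c : a < b -> smooth_curve A a b c ->
  exists l, arc_length_function a b c l.
Proof.
move=> ab /smooth_curveP[U sc abU]; have [oU _ _] := sc.
have [a' [b' [a'a bb' abU']]] := open_segment_enlarge (ltW ab) oU abU.
exists (fun x => \int[lebesgue_measure]_(t in `[a', x]) speed g c t) => t /andP[at_ tb].
have a't : a' < t by apply: lt_le_trans at_.
have tb' : t < b' by apply: le_lt_trans bb'.
have [||d1 d2] := @continuous_FTC1_closed _ (speed g c) a' t b' tb' _ a't.
- apply: continuous_compact_integrable; first exact: segment_compact.
  apply: continuous_in_subspaceT => s /set_mem/abU' Us; exact: (speed_continuous sc Us).
- by apply: (speed_continuous sc); apply: abU'; rewrite /= in_itv/= !ltW.
by apply: (DeriveDef d1); rewrite -derive1E.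
Qed.

Lemma arc_length_continuous (a b : R) c l : arc_length_function a b c l ->
  {within `[a, b], continuous l}.
Proof.
move=> dl; apply: derivable_within_continuous => t; rewrite in_itv/= => abt.
exact: (@ex_derive _ _ _ _ _ _ _ (dl t abt)).
Qed.

Lemma curve_lengthE (a b : R) c l : a < b -> smooth_curve A a b c ->
  arc_length_function a b c l -> curve_length g a b c = l b - l a.
Proof.
move=> ab /smooth_curveP[U sc abU] dl.
rewrite /curve_length /Rintegral.
have := @continuous_FTC2 _ (speed g c) l a b ab _ _ _; rewrite /speed => ->//.
- apply: continuous_in_subspaceT => s /set_mem/abU Us; exact: (speed_continuous sc Us).
- have := arc_length_continuous dl => /continuous_within_itvP -/(_ ab)[_ ca cb].
  split=> // t; rewrite in_itv/= => /andP[at_ tb].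
  by have := dl t; rewrite !ltW// => /(_ isT) H; exact: ex_derive.
- move=> t; rewrite in_itv/= => /andP[at_ tb]; rewrite derive1E.
  by have := dl t; rewrite !ltW// => /(_ isT) H; exact: derive_val.
Qed.

Lemma smooth_curve_sub (a b a' b' : R) c : a <= a' -> b' <= b ->
  smooth_curve A a b c -> smooth_curve A a' b' c.
Proof.
move=> aa' b'b /smooth_curveP[U sc abU]; apply/smooth_curveP; exists U => // t /=.
rewrite in_itv/= => /andP[h1 h2]; apply: abU; rewrite /= in_itv/=.
by rewrite (le_trans aa')//= (le_trans h2).
Qed.

Lemma arc_length_function_sub (a b a' b' : R) c l : a <= a' -> b' <= b ->
  arc_length_function a b c l -> arc_length_function a' b' c l.
Proof.
move=> aa' b'b H t /andP[h1 h2]; apply: H.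
by rewrite (le_trans aa')//= (le_trans h2).
Qed.

Lemma curve_length_ge0 (a b : R) c : 0 <= curve_length g a b c.
Proof. by apply: Rintegral_ge0 => t _; exact: sqrtr_ge0. Qed.

Lemma arc_length_nondecreasing (a b : R) c l s t : arc_length_function a b c l ->
  a <= s -> s <= t -> t <= b -> l s <= l t.
Proof.
move=> dl as_ st tb; rewrite le_eqVlt in st; case/predU1P : st => [->//|st].
have [||x _ E] := @MVT _ l (speed g c) s t st.
- move=> x; rewrite in_itv/= => /andP[sx xt]; apply: dl.
  by rewrite (le_trans as_ (ltW sx)) (le_trans (ltW xt) tb).
- exact: (arc_length_continuous (arc_length_function_sub as_ tb dl)).
by rewrite -subr_ge0 E mulr_ge0 ?speed_ge0// subr_ge0 ltW.
Qed.

End ArcLength.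

(** * Reparametrized and glued curves *)

Section Reparametrization.
Context {R : realType} {m : nat} {M : topologicalType}.
Variables (A : smooth_manifold R m M) (g : riemannian_metric A).
Implicit Types (i j : chart A) (c : R -> M) (U V : set R).

Lemma smooth_path_comp U V c (s : R^o -> R^o) : open V ->
  (forall t, V t -> U (s t)) -> (forall k, Ck_on k (V : set R^o) s) ->
  smooth_path A U c -> smooth_path A V (c \o s).
Proof.
move=> oV VU Cs [oU cc sc].
have ccs t : V t -> {for t, continuous (c \o s)}.
  move=> Vt; apply: continuous_comp; first exact: (Cs 0%N).
  exact/cc/VU.
split=> // i k.
apply: (@Ck_comp _ _ k _ (U `&` c @^-1` dom i) (coord i \o c) s).
- exact: preimage_dom_open.
- by move=> t [Vt it]; split => //; exact: VU.
- exact: sc.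
- by apply: Ck_subset (Cs k) => t [].
Qed.

(** The velocity is multiplied by the derivative of the reparametrization, and the
metric is homogeneous of degree two. *)
Lemma speed_comp U V c (s : R^o -> R^o) t : open V ->
  (forall t, V t -> U (s t)) -> (forall k, Ck_on k (V : set R^o) s) ->
  smooth_path A U c -> V t ->
  speed g (c \o s) t = `|'D_1 s t| * speed g c (s t).
Proof.
move=> oV VU Cs sc Vt; have [i it] := dom_cover A (c (s t)).
have scs := smooth_path_comp oV VU Cs sc.
rewrite (smooth_path_speed g scs Vt it) (smooth_path_speed g sc (VU _ Vt) it).
have ds : derivable s t 1 by have [H _] := Cs 1%N; apply: diff_derivable; exact: H.
have dc : derivable (coord i \o c : R^o -> 'rV[R]_m) (s t) 1.
  exact: (diff_derivable (smooth_path_differentiable sc (VU _ Vt) it)).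
have H := is_derive_comp_line 1 dc ds.
rewrite -[in LHS]/((coord i \o c : R^o -> 'rV[R]_m) \o s) (@derive_val _ _ _ _ _ _ _ H).
rewrite chart_metric_scale; last by exists (c (s t)).
by rewrite sqrtrM ?sqr_ge0// sqrtr_sqr.
Qed.

Lemma near_eq_speed c c' t : (\forall s \near t, c s = c' s) ->
  speed g c t = speed g c' t.
Proof.
move=> cc'; rewrite /speed; have E := nbhs_singleton cc'.
rewrite -[c t]/(c t) E; suff -> : @velocity _ _ _ A c t = velocity c' t by [].
apply/funext => i; rewrite /velocity E; case: ifP => // _.
by apply: near_eq_derive; apply: filterS cc' => s /= ->.
Qed.

Lemma near_cst_speed U c t q : smooth_path A U c -> U t ->
  (\forall s \near t, c s = q) -> speed g c t = 0.
Proof.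
move=> sc Ut cq; have [i it] := dom_cover A (c t).
rewrite (smooth_path_speed g sc Ut it).
have -> : 'D_1 (coord i \o c : R^o -> 'rV[R]_m) t = 0.
  rewrite -[RHS](derive_cst (coord i q) t 1); apply: near_eq_derive.
  by apply: filterS cq => s /= ->.
rewrite -(scale0r 0) chart_metric_scale; last by exists (c t).
by rewrite expr0n mul0r sqrtr0.
Qed.

(** In the applications both paths are constant beyond the parameter 0, where
they meet. *)
Definition glue_paths (p1 p2 : R -> M) (t : R) : M := if t < 0 then p1 t else p2 t.

(** Near the parameter 0 the glued path is, in a chart around the meeting point
[q], the sum of both paths minus [coord i q], because at each parameter one of
the two is at [q].  A sum of smooth maps is smooth. *)
Lemma glue_smooth (W : set R) (p1 p2 : R -> M) q :
  smooth_path A W p1 -> smooth_path A W p2 ->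
  (forall t, 0 <= t -> p1 t = q) -> (forall t, t <= 0 -> p2 t = q) ->
  smooth_path A W (glue_paths p1 p2).
Proof.
move=> s1 s2 q1 q2; have [oW c1 sm1] := s1; have [_ c2 sm2] := s2.
have gl t : t < 0 -> glue_paths p1 p2 t = p1 t by rewrite /glue_paths => ->.
have gr t : 0 <= t -> glue_paths p1 p2 t = p2 t by rewrite /glue_paths ltNge => ->.
have cg t : W t -> {for t, continuous (glue_paths p1 p2)}.
  move=> Wt; have [t0|t0] := ltP t 0.
    suff : glue_paths p1 p2 @ t --> p1 t by rewrite -(gl t).
    apply: cvg_trans (c1 _ Wt); apply: near_eq_cvg.
    by apply: filterS (lt_nbhsl t0) => s s0; rewrite gl.
  have [t0'|t0'] := ltP 0 t.
    suff : glue_paths p1 p2 @ t --> p2 t by rewrite -(gr t).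
    apply: cvg_trans (c2 _ Wt); apply: near_eq_cvg.
    by apply: filterS (lt_nbhsr t0') => s s0; rewrite gr// ltW.
  have t00 : t = 0 by apply/eqP; rewrite eq_le t0 t0'.
  suff : glue_paths p1 p2 @ t --> q by rewrite -(q2 t)// -gr.
  have H1 := c1 _ Wt; have H2 := c2 _ Wt.
  rewrite /prop_for /continuous_at (q1 t)// in H1.
  rewrite /prop_for /continuous_at (q2 t)// in H2.
  move=> P Pq; have N1 : nbhs t (p1 @^-1` P) := H1 _ Pq.
  have N2 : nbhs t (p2 @^-1` P) := H2 _ Pq.
  change (nbhs t (glue_paths p1 p2 @^-1` P)).
  apply: (@filterS _ _ (nbhs_filter t) _ _ _ (filterI N1 N2)) => s [P1 P2].
  by rewrite /preimage /= /glue_paths; case: ifP.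
split=> // i k; apply: Ck_local => t [Wt it].
have [t0|t0|t0] := ltgtP t 0.
- exists ((W `&` p1 @^-1` dom i) `&` [set s | s < 0]), (coord i \o p1); split.
  + by apply: openI; [exact: smooth_path_open s1|exact: open_lt].
  + by split => //; split => //; move: it; rewrite /= gl.
  + by apply: Ck_subset (sm1 i k) => s [].
  + by move=> s [_ /= s0]; rewrite gl.
- exists ((W `&` p2 @^-1` dom i) `&` [set s | s > 0]), (coord i \o p2); split.
  + by apply: openI; [exact: smooth_path_open s2|exact: open_gt].
  + by split => //; split => //; move: it; rewrite /= gr// ltW.
  + by apply: Ck_subset (sm2 i k) => s [].
  + by move=> s [_ /= s0]; rewrite gr// ltW.
- have iq : dom i q by move: it; rewrite /= gr ?t0// q2.
  pose B := (W `&` p1 @^-1` dom i) `&` (W `&` p2 @^-1` dom i).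
  have oB : open B by apply: openI; [exact: smooth_path_open s1|exact: smooth_path_open s2].
  exists B, (fun s => ((coord i \o p1) s + (coord i \o p2) s) + cst (- coord i q) s); split => //.
  + by rewrite t0 in Wt *; split; split; rewrite //= ?q1 ?q2.
  + apply: Ck_add => //; first apply: Ck_add => //.
    * by apply: Ck_subset (sm1 i k) => s [].
    * by apply: Ck_subset (sm2 i k) => s [].
    * exact: Ck_cst.
  + move=> s _; rewrite /=; have [s0|s0] := ltP s 0.
      by rewrite gl// (q2 s) ?ltW// addrK.
    by rewrite gr// (q1 s)// [_ + coord i (p2 s)]addrC addrK.
Unshelve. all: by end_near. Qed.

(** Off the parameter 0 one of the two speeds vanishes and the glued path
coincides with the other path; at 0 the identity follows by continuity. *)
Lemma speed_glue (W : set R) (p1 p2 : R -> M) q t :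
  smooth_path A W p1 -> smooth_path A W p2 ->
  (forall t, 0 <= t -> p1 t = q) -> (forall t, t <= 0 -> p2 t = q) -> W t ->
  speed g (glue_paths p1 p2) t = speed g p1 t + speed g p2 t.
Proof.
move=> s1 s2 q1 q2 Wt.
have sg := glue_smooth s1 s2 q1 q2; have [oW _ _] := sg.
have neq t' : W t' -> t' != 0 -> speed g (glue_paths p1 p2) t' = speed g p1 t' + speed g p2 t'.
  move=> Wt'; case: (ltgtP t' 0) => // t0 _.
    rewrite (near_cst_speed (q := q) s2 Wt'); last first.
      by near=> s; apply: q2; rewrite ltW//; near: s; exact: lt_nbhsl.
    rewrite addr0; apply: near_eq_speed; near=> s; rewrite /glue_paths ifT//.
    by near: s; exact: lt_nbhsl.
  rewrite (near_cst_speed (q := q) s1 Wt'); last first.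
    by near=> s; apply: q1; rewrite ltW//; near: s; exact: lt_nbhsr.
  rewrite add0r; apply: near_eq_speed; near=> s; rewrite /glue_paths ifF//.
  by apply/negbTE; rewrite -leNgt ltW//; near: s; exact: lt_nbhsr.
have [t0|t0] := eqVneq t 0; last exact: neq.
have cvgw (f : R -> R) : {for t, continuous f} -> f s @[s --> t^'] --> f t.
  by move=> /continuous_withinNx.
have l1 := cvgw _ (speed_continuous (g := g) sg Wt).
have l2 : (fun s => speed g p1 s + speed g p2 s) @ t^' --> speed g p1 t + speed g p2 t :=
  cvgD (cvgw _ (speed_continuous (g := g) s1 Wt)) (cvgw _ (speed_continuous (g := g) s2 Wt)).
suff l3 : speed g (glue_paths p1 p2) @ t^' --> speed g p1 t + speed g p2 t.
  exact: (cvg_unique (@Rhausdorff R) l1 l3).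
move=> P /l2 lP; change (t^' (speed g (glue_paths p1 p2) @^-1` P)).
have nW : t^' W by apply: nbhs_dnbhs; exact: open_nbhs_nbhs.
have n0 : t^' [set s | s != t] by near=> s; near: s; exact: nbhs_dnbhs_neq.
have lP' : t^' [set s | P (speed g p1 s + speed g p2 s)] := lP.
near=> s; rewrite /preimage/= neq.
- by near: s; exact: lP'.
- by near: s; exact: nW.
- by rewrite -t0; near: s; exact: n0.
Unshelve. all: by end_near. Qed.

End Reparametrization.

(** * Lengths of curves joining two points *)

Section Joining.
Context {R : realType} {m : nat} {M : topologicalType}.
Variables (A : smooth_manifold R m M) (g : riemannian_metric A).
Implicit Types (i j : chart A) (c : R -> M) (p q : M).

(** [inner_metric g p q] is the infimum of the [L] with [joined p q L]. *)
Definition joined p q (L : R) : Prop :=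
  exists a b c, [/\ a < b, smooth_curve A a b c, c a = p, c b = q &
    L = curve_length g a b c].

Lemma joined_ge0 p q L : joined p q L -> 0 <= L.
Proof. by move=> [a [b [c [_ _ _ _ ->]]]]; exact: curve_length_ge0. Qed.

Lemma joinedP p q L : joined p q L <-> exists a b c l,
  [/\ a < b, smooth_curve A a b c, c a = p /\ c b = q,
      arc_length_function g a b c l & L = l b - l a].
Proof.
split=> [[a [b [c [ab sc ca cb ->]]]]|[a [b [c [l [ab sc [ca cb] dl ->]]]]]].
  have [l dl] := arc_length_function_exists g ab sc.
  by exists a, b, c, l; split => //; rewrite (curve_lengthE ab sc dl).
by exists a, b, c; split => //; rewrite (curve_lengthE ab sc dl).
Qed.

Lemma transition_domain_open i j : open (coord i @` (dom i `&` dom j)).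
Proof.
rewrite openE => x [p [ip jp] <-].
apply: filterS (near_chart_image ip jp) => y [/chart_image_param[iy yE] jy].
by exists (param i y).
Qed.

Lemma chart_segment_path i (x v : 'rV[R]_m) (U : set R) : open U ->
  (forall t, U t -> (coord i @` dom i) (x + t *: v)) ->
  smooth_path A U (fun t => param i (x + t *: v)).
Proof.
move=> oU UI.
have cl : continuous (fun t : R^o => x + t *: v).
  by move=> t; apply: cvgD; [exact: cvg_cst|apply: cvgZr_tmp].
split=> // [t Ut|j k].
  apply: (@continuous_comp _ _ _ (fun t : R^o => x + t *: v) (param i)).
    exact: cl.
  exact: param_continuous (UI _ Ut).
have := @Ck_line R _ _ k _ (coord j \o param i) x v (@transition_domain_open i j)
  (@transition_smooth _ _ _ _ i j k).
apply: Ck_subset => t [Ut jt] /=.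
have [it tE] := chart_image_param (UI _ Ut).
by exists (param i (x + t *: v)).
Qed.

Lemma chart_segment_speed i (x v : 'rV[R]_m) (U : set R) t : open U ->
  (forall t, U t -> (coord i @` dom i) (x + t *: v)) -> U t ->
  speed g (fun t => param i (x + t *: v)) t =
    Num.sqrt (chart_metric g i (x + t *: v) v v).
Proof.
move=> oU UI Ut; have sc := chart_segment_path oU UI.
have [it tE] := chart_image_param (UI _ Ut).
rewrite (smooth_path_speed g sc Ut it) /= tE.
suff -> : 'D_1 (coord i \o (fun t => param i (x + t *: v)) : R^o -> 'rV[R]_m) t = v by [].
have H : is_derive t (1 : R^o) (fun s : R^o => id (x + s *: v)) ('D_(1 *: v) id (x + t *: v)).
  exact: is_derive_line.
rewrite derive_id scale1r in H.
rewrite -[RHS](@derive_val _ _ _ _ _ _ _ H); apply: near_eq_derive.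
have : nbhs t U by exact: open_nbhs_nbhs.
by apply: filterS => s Us /=; have [_] := chart_image_param (UI _ Us).
Qed.

(** The coordinate segment from [x] to [y] stays in the ball by convexity, and has
coordinate velocity [y - x] throughout. *)
Lemma chart_segment_joined i (x0 x y : 'rV[R]_m) (s C : R) :
  (forall z, `|z - x0| < s -> (coord i @` dom i) z) ->
  (forall z w, `|z - x0| < s -> Num.sqrt (chart_metric g i z w w) <= C * `|w|) ->
  `|x - x0| < s -> `|y - x0| < s ->
  exists2 L, joined (param i x) (param i y) L & L <= C * `|x - y|.
Proof.
move=> sI sC xs ys; pose v := y - x.
pose U := [set t : R | `|x + t *: v - x0| < s].
have cl : continuous (fun t : R^o => `|x + t *: v - x0|).
  move=> t; apply: cvg_norm; apply: cvgB; last exact: cvg_cst.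
  by apply: cvgD; [exact: cvg_cst|apply: cvgZr_tmp].
have oU : open U.
  by apply: (@open_comp _ _ (fun t : R^o => `|x + t *: v - x0|) [set r | r < s]) =>
    [t _|]; [exact: cl|exact: open_lt].
have UI t : U t -> (coord i @` dom i) (x + t *: v) by move=> Ut; exact: sI.
have sc := chart_segment_path oU UI.
have U01 : `[0, 1] `<=` U.
  move=> t; rewrite /= in_itv/= => /andP[t0 t1]; rewrite /U/=.
  have -> : x + t *: v - x0 = (1 - t) *: (x - x0) + t *: (y - x0).
    rewrite (_ : y - x0 = v + (x - x0)); last by rewrite /v addrA subrK.
    by rewrite [t *: (v + _)]scalerDr addrCA -scalerDl subrK scale1r addrA [t *: v + x]addrC.
  rewrite (le_lt_trans (ler_normD _ _))// !normrZ (ger0_norm t0) ger0_norm ?subr_ge0//.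
  have [->|tn0] := eqVneq t 0; first by rewrite subr0 mul1r mul0r addr0.
  have tp : 0 < t by rewrite lt_neqAle eq_sym tn0.
  have h1 : t * `|y - x0| < t * s by rewrite ltr_pM2l.
  have h2 : (1 - t) * `|x - x0| <= (1 - t) * s by rewrite ler_wpM2l ?subr_ge0// ltW.
  lra.
have sc01 : smooth_curve A 0 1 (fun t => param i (x + t *: v)).
  by apply/smooth_curveP; exists U.
have [l dl] := arc_length_function_exists g ltr01 sc01.
exists (l 1 - l 0).
  apply/joinedP; exists 0, 1, (fun t => param i (x + t *: v)), l; split => //.
  by rewrite scale0r addr0 scale1r /v addrC subrK.
have [||t t01 ->] := @MVT _ l (speed g (fun t => param i (x + t *: v))) 0 1 ltr01.
- by move=> t; rewrite in_itv/= => /andP[t0 t1]; apply: dl; rewrite !ltW.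
- exact: (arc_length_continuous dl).
have Ut : U t by apply: U01; rewrite /=; exact: subset_itv_oo_cc.
rewrite subr0 mulr1 (chart_segment_speed oU UI Ut) distrC.
exact: sC.
Qed.

Lemma joined_sym p q L : joined p q L -> joined q p L.
Proof.
move=> /joinedP[a [b [c [l [ab sc [ca cb] dl ->]]]]].
apply/joinedP; exists (- b), (- a), (c \o -%R), (- (l \o -%R)).
have /smooth_curveP[U pc abU] := sc; have [oU _ _] := pc.
pose V := [set t : R | U (- t)].
have oV : open V by apply: open_comp => // t _; exact: opp_continuous.
have Cs k : Ck_on k (V : set R^o) (-%R : R^o -> R^o) by exact: Ck_opp.
have VU t : V t -> U (- t) by [].
split.
- by rewrite ltrN2.
- apply/smooth_curveP; exists V; first exact: (smooth_path_comp oV VU Cs pc).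
  by move=> t; rewrite /= in_itv/= => tab; apply: abU; rewrite /= in_itv/= lerNr lerNl andbC.
- by rewrite /= !opprK.
- move=> t tab; have tab' : a <= - t <= b by rewrite lerNr lerNl andbC.
  have Vt : V t by apply: abU; rewrite /= in_itv.
  rewrite (speed_comp g oV VU Cs pc Vt).
  have dN : is_derive t 1 (-%R : R -> R) (-1) by exact: is_deriveNid.
  rewrite (@derive_val _ _ _ _ _ _ _ dN) normrN1 mul1r.
  have := @is_derive1_comp _ l (-%R) t _ _ (dl _ tab') dN.
  by move=> /is_deriveN; rewrite mulrN1 opprK.
- have lN t : (- (l \o -%R)) (- t) = - l t by rewrite -[LHS]/(- l (- - t)) opprK.
  by rewrite !lN opprK addrC.
Qed.

End Joining.

(** * Concatenation of smooth curves *)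

Section Step.
Context {R : realType}.

(** The factor [expR 1] normalizes the value at 1. *)
Definition flat_step : R^o -> R^o := flat (expR 1)%:P.

Lemma flat_step_le0 t : t <= 0 -> flat_step t = 0.
Proof. by move=> t0; rewrite /flat_step /flat ltNge t0. Qed.

Lemma flat_step1 : flat_step 1 = 1.
Proof. by rewrite /flat_step /flat ltr01 hornerC invr1 expRxMexpNx_1. Qed.

Lemma flat_step_itv t : t <= 1 -> 0 <= flat_step t <= 1.
Proof.
move=> t1; rewrite /flat_step /flat; case: ifPn => [t0|_]; last by rewrite lexx ler01.
rewrite hornerC mulr_ge0 ?expR_ge0//= -expRD -[leRHS]expR0 ler_expR subr_le0.
by rewrite invf_ge1.
Qed.

Lemma is_derive_flat_step (t : R^o) :
  exists2 k, 0 <= k & is_derive t 1 flat_step k.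
Proof.
have H := is_derive_flat (expR 1)%:P t; eexists; last exact: H.
rewrite derivC subr0 /flat; case: ifPn => // t0.
by rewrite mulr_ge0 ?expR_ge0// hornerM hornerXn hornerC mulr_ge0 ?expR_ge0// sqr_ge0.
Qed.

(** For [b < a], composing with [-%R] gives an increasing motion that comes to rest
at 0. *)
Definition flat_ramp (a b : R) (t : R^o) : R^o := a + (b - a) *: flat_step t.

Lemma flat_ramp_smooth a b k : Ck_on k setT (flat_ramp a b).
Proof.
apply: (Ck_add openT); first exact: Ck_cst.
by apply: (Ck_scale openT); [exact: Ck_cst|exact: flat_smooth].
Qed.

Lemma is_derive_flat_ramp a b (t : R^o) :
  exists2 k, 0 <= k & is_derive t 1 (flat_ramp a b) ((b - a) * k).
Proof.
have [k k0 H] := is_derive_flat_step t; exists k => //.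
have H2 := is_deriveZ (b - a) H.
have := @is_deriveD _ _ _ (cst (a : R^o)) _ t 1 0 _ (is_derive_cst _ _ _) H2.
by rewrite add0r.
Qed.

Lemma flat_ramp_le0 a b t : t <= 0 -> flat_ramp a b t = a.
Proof. by move=> t0; rewrite /flat_ramp flat_step_le0// scaler0 addr0. Qed.

Lemma flat_ramp1 a b : flat_ramp a b 1 = b.
Proof. by rewrite /flat_ramp flat_step1 [_ *: _]mulr1 addrC subrK. Qed.

Lemma flat_ramp_incr_itv a b t : a <= b -> t <= 1 -> a <= flat_ramp a b t <= b.
Proof.
move=> ab /flat_step_itv/andP[s0 s1]; rewrite /flat_ramp [_ *: _]/(_ * _).
have h1 : 0 <= (b - a) * flat_step t by rewrite mulr_ge0// subr_ge0.
have h2 : (b - a) * flat_step t <= b - a by rewrite ler_piMr// subr_ge0.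
by rewrite lerDl h1 /= -lerBrDl.
Qed.

Lemma flat_ramp_decr_itv a b t : a <= b -> t <= 1 -> a <= flat_ramp b a t <= b.
Proof.
move=> ab /flat_step_itv/andP[s0 s1].
have -> : flat_ramp b a t = b - (b - a) * (flat_step t : R).
  by rewrite -mulNr opprB.
have h1 : 0 <= (b - a) * flat_step t by rewrite mulr_ge0// subr_ge0.
have h2 : (b - a) * flat_step t <= b - a by rewrite ler_piMr// subr_ge0.
by rewrite lerBrDr -lerBrDl gerBl h1 h2.
Qed.

End Step.

Section Concatenation.
Context {R : realType} {m : nat} {M : topologicalType}.
Variables (A : smooth_manifold R m M) (g : riemannian_metric A).
Implicit Types (p q r : M).

(** The first curve is run through on [-1, 0] and the second one on [0, 1], both
with velocity flat at 0, so that they can be glued there.  Reparametrizing keeps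
the lengths because the sum of the two reparametrized arc length functions is an
arc length function of the glued path. *)
Lemma joined_trans p q r L1 L2 :
  joined g p q L1 -> joined g q r L2 -> joined g p r (L1 + L2).
Proof.
move=> /joinedP[a1 [b1 [c1 [l1 [ab1 sc1 [ca1 cb1] dl1 ->]]]]].
move=> /joinedP[a2 [b2 [c2 [l2 [ab2 sc2 [ca2 cb2] dl2 ->]]]]].
have /smooth_curveP[U1 pc1 abU1] := sc1; have [oU1 _ _] := pc1.
have /smooth_curveP[U2 pc2 abU2] := sc2; have [oU2 _ _] := pc2.
(* [s1] rests at [b1] for nonnegative, [s2] at [a2] for nonpositive parameters. *)
pose s1 : R^o -> R^o := flat_ramp b1 a1 \o -%R.
pose s2 : R^o -> R^o := flat_ramp a2 b2.
have C1 k (V : set R^o) : Ck_on k V s1.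
  apply: (@Ck_subset _ _ _ _ setT) => //; apply: (Ck_comp (B := setT)) => //.
  - exact: openT.
  - exact: flat_ramp_smooth.
  - exact: Ck_opp.
have C2 k (V : set R^o) : Ck_on k V s2.
  by apply: (@Ck_subset _ _ _ _ setT) => //; exact: flat_ramp_smooth.
have d1 (t : R^o) : exists2 k, 0 <= k & is_derive t 1 s1 k.
  have [k k0 H] := is_derive_flat_ramp b1 a1 (- t).
  exists ((b1 - a1) * k); first by rewrite mulr_ge0// subr_ge0 ltW.
  have := @is_derive1_comp _ _ (-%R) t _ _ H (is_deriveNid _ _).
  by rewrite mulrN1 -mulNr opprB.
have d2 (t : R^o) : exists2 k, 0 <= k & is_derive t 1 s2 k.
  have [k k0 H] := is_derive_flat_ramp a2 b2 t.
  by exists ((b2 - a2) * k); first by rewrite mulr_ge0// subr_ge0 ltW.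
pose W : set R := [set t | U1 (s1 t)] `&` [set t | U2 (s2 t)].
have oW : open W.
  apply: openI.
    by apply: (@open_comp _ _ s1) => // t _; exact: (C1 0%N setT).
  by apply: (@open_comp _ _ s2) => // t _; exact: (C2 0%N setT).
have WU1 t : W t -> U1 (s1 t) by case.
have WU2 t : W t -> U2 (s2 t) by case.
have P1 := smooth_path_comp oW WU1 (fun k => C1 k W) pc1.
have P2 := smooth_path_comp oW WU2 (fun k => C2 k W) pc2.
have q1 t : 0 <= t -> (c1 \o s1) t = q.
  by move=> t0; rewrite /= /s1/= flat_ramp_le0// oppr_le0.
have q2 t : t <= 0 -> (c2 \o s2) t = q.
  by move=> t0; rewrite /= /s2 flat_ramp_le0.
have i1 t : -1 <= t <= 1 -> a1 <= s1 t <= b1.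
  by move=> /andP[t1 t2]; apply: flat_ramp_decr_itv; [exact: ltW|rewrite lerNl].
have i2 t : -1 <= t <= 1 -> a2 <= s2 t <= b2.
  by move=> /andP[t1 t2]; apply: flat_ramp_incr_itv => //; exact: ltW.
have IW t : -1 <= t <= 1 -> W t.
  move=> t11; split; first by apply: abU1; rewrite /= in_itv/= i1.
  by apply: abU2; rewrite /= in_itv/= i2.
apply/joinedP; exists (-1), 1, (glue_paths (c1 \o s1) (c2 \o s2)), ((l1 \o s1) + (l2 \o s2)).
split.
- exact: lt_trans (ltrN10 _) ltr01.
- apply/smooth_curveP; exists W; first exact: glue_smooth P1 P2 q1 q2.
  by move=> t /=; rewrite in_itv/=; exact: IW.
- rewrite /glue_paths ltrN10 ltr10 /= /s1 /s2 /= opprK !flat_ramp1.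
  by split.
- move=> t t11; have Wt := IW t t11.
  rewrite (speed_glue g P1 P2 q1 q2 Wt).
  rewrite (speed_comp g oW WU1 (fun k => C1 k W) pc1 Wt).
  rewrite (speed_comp g oW WU2 (fun k => C2 k W) pc2 Wt).
  have [k1 k10 H1] := d1 t; have [k2 k20 H2] := d2 t.
  rewrite (@derive_val _ _ _ _ _ _ _ H1) (@derive_val _ _ _ _ _ _ _ H2) !ger0_norm//.
  rewrite (mulrC k1) (mulrC k2).
  have D1 := @is_derive1_comp _ l1 s1 t _ _ (dl1 _ (i1 t t11)) H1.
  have D2 := @is_derive1_comp _ l2 s2 t _ _ (dl2 _ (i2 t t11)) H2.
  exact: is_deriveD.
- rewrite !fctE /s1 /s2 /= opprK !flat_ramp1.
  rewrite (flat_ramp_le0 b1 a1 (t := -1)) ?(flat_ramp_le0 a2 b2 (t := -1)) ?cb1 //; lra.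
Qed.

End Concatenation.

(** * The inner metric as a length metric *)

Section InnerMetric.
Context {R : realType} {m : nat} {M : topologicalType}.
Variables (A : smooth_manifold R m M) (g : riemannian_metric A).
Implicit Types (i j : chart A) (c : R -> M) (p q : M).

Lemma open_chart_ball i x0 (s : R) : open (dom i `&` [set q | `|coord i q - x0| < s]).
Proof.
rewrite openE => q [iq /= qs]; apply: filterI; first exact: dom_nbhs.
have cf := @continuous_norm_sub R 'rV[R]_m x0.
have : {for q, continuous (fun q => `|coord i q - x0|)}.
  apply: (@continuous_comp _ _ _ (coord i) (fun x => `|x - x0|)); last exact: cf.
  exact: coord_continuous.
move=> /(_ [set r | r < s]); apply.
by apply: open_nbhs_nbhs; split => //; exact: open_lt.
Qed.

(** The local upper bound for the inner metric, freed from charts. *)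
Lemma chart_nbhd p : exists (V : set M) (phi : M -> 'rV[R]_m) (B C : R),
  [/\ open V, V p, 0 < C, forall q, V q -> `|phi q| <= B &
    forall q q', V q -> V q' ->
      exists2 L, joined g q q' L & L <= C * `|phi q - phi q'|].
Proof.
have [i ip] := dom_cover A p.
have Ip : (coord i @` dom i) (coord i p) by exists p.
have [s [kappa [C [s0 k0 C0 sI H]]]] := chart_metric_bounds g Ip.
exists (dom i `&` [set q | `|coord i q - coord i p| < s]), (coord i),
  (s + `|coord i p|), C; split => //.
- exact: open_chart_ball.
- by split => //=; rewrite subrr normr0.
- move=> q [_ /= qs]; rewrite -[coord i q](subrK (coord i p)).
  by rewrite (le_trans (ler_normD _ _))// lerD2r ltW.
move=> q q' [iq qs] [iq' qs'].
rewrite -{1}(coordK iq) -{1}(coordK iq').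
apply: (chart_segment_joined sI) qs qs' => z w zs.
by have /andP[] := H z w zs.
Qed.

Lemma joined_refl p : joined g p p 0.
Proof.
have [V [phi [B [C [_ Vp _ _ /(_ p p Vp Vp)[L JL]]]]]] := chart_nbhd p.
rewrite subrr normr0 mulr0 => L0.
suff <- : L = 0 by [].
by apply/eqP; rewrite eq_le L0 (joined_ge0 JL).
Qed.

Lemma inner_metric_ge0 p q : 0 <= inner_metric g p q.
Proof.
have [E0|/set0P E0] := eqVneq [set L | joined g p q L] set0.
  by rewrite /inner_metric -/(joined g p q) [X in inf X]E0 inf0.
by apply: lb_le_inf => // L; exact: joined_ge0.
Qed.

Lemma inner_metric_le p q L : joined g p q L -> inner_metric g p q <= L.
Proof.
by move=> JL; apply: ge_inf => //; exists 0 => L'; exact: joined_ge0.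
Qed.

Lemma inner_metric_refl p : inner_metric g p p = 0.
Proof.
by apply/eqP; rewrite eq_le inner_metric_ge0 inner_metric_le//; exact: joined_refl.
Qed.

Lemma inner_metric_sym p q : inner_metric g p q = inner_metric g q p.
Proof.
rewrite /inner_metric; congr inf; apply/seteqP.
by split => L /joined_sym.
Qed.

(** Each coordinate grows at most as fast as the arc length divided by [kappa]: the
mean value theorem for the arc length minus [kappa] times plus or minus that
coordinate. *)
Lemma chart_arc_estimate i (a u kappa : R) c U (l : R -> R) : 0 < kappa -> a < u ->
  smooth_path A U c -> arc_length_function g a u c l ->
  (forall t, a <= t <= u -> [/\ U t, dom i (c t) &
    kappa * `|'D_1 (coord i \o c : R^o -> 'rV[R]_m) t| <= speed g c t]) ->
  kappa * `|coord i (c u) - coord i (c a)| <= l u - l a.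
Proof.
move=> k0 au sc dl H; rewrite mulrC -ler_pdivlMr//.
have lau : 0 <= l u - l a by rewrite subr_ge0 (arc_length_nondecreasing dl)// ltW.
apply: norm_le_coord => [|k]; first by rewrite divr_ge0// ltW.
pose f : R -> R := fun t => coord i (c t) 0 k.
pose w t := 'D_1 (coord i \o c : R^o -> 'rV[R]_m) t.
have df t : a <= t <= u -> is_derive t 1 f (w t 0 k).
  move=> /H[Ut it _].
  have dc : derivable (coord i \o c : R^o -> 'rV[R]_m) t 1.
    exact: (diff_derivable (smooth_path_differentiable sc Ut it)).
  have dck := (derivable_mxP _ _ _).1 dc 0 k.
  by apply: (DeriveDef dck); rewrite /w derive_mx// mxE.
have [||x xau fE] := @MVT _ f (fun t => w t 0 k) a u au.
- by move=> x; rewrite in_itv/= => /andP[ax xu]; apply: df; rewrite !ltW.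
- apply: derivable_within_continuous => t; rewrite in_itv/= => /df D; exact: ex_derive.
(* [e] is the sign of the increment of the coordinate. *)
suff key (e : R) : `|e| = 1 -> kappa * (e * (f u - f a)) <= l u - l a.
  rewrite !mxE -/(f u) -/(f a) ler_norml; apply/andP; split.
    rewrite lerNl ler_pdivlMr// mulrC -[X in kappa * X]mulN1r.
    by apply: key; rewrite normrN1.
  by rewrite ler_pdivlMr// mulrC -[X in kappa * X]mul1r; apply: key; rewrite normr1.
move=> e1.
have dh t : a <= t <= u -> is_derive t 1 (fun t => l t - kappa * e * f t)
    (speed g c t - kappa * e * w t 0 k).
  move=> tau; have D1 := dl t tau; have D2 := df t tau.
  exact: (is_deriveB D1 (is_deriveZ (kappa * e) D2)).
have [||y yau hE] := @MVT _ (fun t => l t - kappa * e * f t)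
    (fun t => speed g c t - kappa * e * w t 0 k) a u au.
- by move=> y; rewrite in_itv/= => /andP[ay yu]; apply: dh; rewrite !ltW.
- apply: derivable_within_continuous => t; rewrite in_itv/= => /dh D; exact: ex_derive.
have yau' : a <= y <= u by move: yau; rewrite in_itv/= => /andP[ay yu]; rewrite !ltW.
have : 0 <= (speed g c y - kappa * e * w y 0 k) * (u - a).
  rewrite mulr_ge0//; last by rewrite subr_ge0 ltW.
  rewrite subr_ge0; have [_ _ Hy] := H y yau'; rewrite (le_trans _ Hy)//.
  rewrite -mulrA (ler_wpM2l (ltW k0))// (le_trans (ler_norm _))// normrM e1 mul1r.
  exact: coord_norm_le.
rewrite -hE => h; rewrite -subr_ge0; move: h; congr (0 <= _); ring.
Qed.

(** Take a coordinate ball [W] of radius [s] whose points lie in [V] and on which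
the lower bound [kappa] holds.  As long as a curve of length less than
[kappa * (s / 2)] has not left [W], it is in the compact half ball [N].  At the
first parameter [tau] outside of [W] it would still be in [N], since [N] is
closed in the Hausdorff space [M]; but [N] is contained in [W]. *)
Lemma chart_escape p (V : set M) : nbhs p V ->
  exists2 eps, 0 < eps & forall q L, joined g p q L -> L < eps -> V q.
Proof.
move=> pV; have [i ip] := dom_cover A p; set x0 := coord i p.
have Ip : (coord i @` dom i) x0 by exists p.
have [s1 [kappa [C [s10 k0 C0 sI H]]]] := chart_metric_bounds g Ip.
have : \forall x \near x0, V (param i x).
  by apply: (param_continuous Ip); rewrite /x0 coordK.
move=> /nbhs_normP[s2 /= s20 Hs2].
pose s := Num.min s1 s2; have s0 : 0 < s by rewrite lt_min s10.
have ss1 : s <= s1 by rewrite ge_min lexx.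
have ss2 : s <= s2 by rewrite ge_min lexx orbT.
pose W := dom i `&` [set q | `|coord i q - x0| < s].
have oW : open W by exact: open_chart_ball.
have WV q : W q -> V q.
  move=> [iq /= qs]; rewrite -(coordK iq); apply: Hs2.
  by rewrite /= distrC (lt_le_trans qs).
pose N := param i @` [set x | `|x - x0| <= s / 2].
have s2s : s / 2 < s by rewrite ltr_pdivrMr// ltr_pMr// ltr1n.
have NI x : `|x - x0| <= s / 2 -> (coord i @` dom i) x.
  by move=> xs; apply: sI; rewrite (le_lt_trans xs)// (lt_le_trans s2s).
have NW : N `<=` W.
  move=> _ [x /= xs <-]; have [ix xE] := chart_image_param (NI x xs).
  by split => //=; rewrite xE (le_lt_trans xs).
have cN : closed N.
  apply: compact_closed; first exact: (manifold_hausdorff A).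
  apply: continuous_compact; last exact: compact_row_ball.
  apply: continuous_in_subspaceT => x /set_mem /= xs.
  exact: param_continuous (NI x xs).
exists (kappa * (s / 2)); first by rewrite mulr_gt0// divr_gt0.
move=> q L /joinedP[a [b [c [l [ab sc [ca cb] dl ->]]]]] Leps; apply: WV.
have /smooth_curveP[U pc abU] := sc; have [oU cc _] := pc.
have Wp : W p by split => //=; rewrite subrr normr0.
apply: contrapT => nWq.
pose E := [set t | a <= t <= b /\ ~ W (c t)].
have Eb : E b by split; [rewrite (ltW ab) lexx|rewrite cb].
have hE : has_inf E by split; [exists b|exists a => t [/andP[]]].
pose tau := inf E.
have atau : a <= tau by apply: lb_le_inf => [|t [/andP[]]//]; exists b.
have taub : tau <= b by apply: ge_inf => //; exists a => t [/andP[]].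
have Utau : U tau by apply: abU; rewrite /= in_itv/= atau taub.
have Wlt t : a <= t -> t < tau -> W (c t).
  move=> at_ ttau; apply: contrapT => nW.
  suff : tau <= t by rewrite leNgt ttau.
  apply: ge_inf; first by exists a => t' [/andP[]].
  by split => //; rewrite at_ (le_trans (ltW ttau)).
have nWtau : ~ W (c tau).
  move=> Wtau.
  have /nbhs_normP[e /= e0 He] : nbhs tau (c @^-1` W).
    by apply: (cc _ Utau); exact: open_nbhs_nbhs.
  have [t [/andP[at_ tb] nWt] tt] := inf_adherent e0 hE.
  apply: (nWt); apply: He; rewrite /=.
  have Et : E t by split; [rewrite at_ tb|].
  have taut : tau <= t by exact: (ge_inf (proj2 hE) Et).
  by rewrite distrC ger0_norm ?subr_ge0// ltrBlDl.
have a_tau : a < tau.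
  rewrite lt_neqAle atau andbT; apply/eqP => E0; apply: nWtau.
  by rewrite -E0 ca.
have Nlt u : a <= u -> u < tau -> N (c u).
  move=> au utau; have Wu := Wlt u au utau.
  have [iu _] := Wu; exists (coord i (c u)); last exact: coordK.
  rewrite /=; have [<-|au'] := eqVneq a u.
    by rewrite ca subrr normr0 divr_ge0// ltW.
  have {}au' : a < u by rewrite lt_neqAle au' au.
  have ub : u <= b by rewrite (le_trans (ltW utau)).
  have dlu := arc_length_function_sub (lexx a) ub dl.
  have := @chart_arc_estimate i a u kappa c U l k0 au' pc dlu.
  rewrite ca -/x0 => est; rewrite -(ler_pM2l k0) (le_trans (est _))//.
    move=> t /andP[at_ tu]; have [it /= ts] := Wlt t at_ (le_lt_trans tu utau).
    have Ut : U t by apply: abU; rewrite /= in_itv/= at_ (le_trans tu).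
    split => //; rewrite (smooth_path_speed g pc Ut it).
    by have /andP[] := H (coord i (c t)) ('D_1 (coord i \o c : R^o -> 'rV[R]_m) t)
      (lt_le_trans ts ss1).
  rewrite (le_trans _ (ltW Leps))// lerD2r (arc_length_nondecreasing dl)//.
apply: nWtau; apply: NW; apply: contrapT => nN.
have /nbhs_normP[e /= e0 He] : nbhs tau (c @^-1` (~` N)).
  by apply: (cc _ Utau); apply: open_nbhs_nbhs; split => //; exact: closed_openC.
pose u := Num.max a (tau - e / 2).
have utau : u < tau by rewrite gt_max a_tau ltrBlDr ltrDl divr_gt0.
have au : a <= u by rewrite le_max lexx.
apply: (He u) (Nlt u au utau); rewrite /= ger0_norm ?subr_ge0 ?ltW//.
have : tau - e / 2 <= u by rewrite le_max lexx orbT.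
lra.
Qed.

Hypothesis M_connected : connected [set: M].

(** The points joined to [p] form an open set, and so do the others, since nearby
points are joined by coordinate segments in both directions. *)
Lemma joined_exists p q : exists L, joined g p q L.
Proof.
pose S := [set q | exists L, joined g p q L].
suff : S = setT by move=> ST; have : S q by rewrite ST.
apply: M_connected.
- by exists p; exists 0; exact: joined_refl.
- exists S; last by rewrite setTI.
  rewrite openE => r [L Lr]; have [V [phi [B [C [oV Vr _ _ HV]]]]] := chart_nbhd r.
  apply: filterS (open_nbhs_nbhs (conj oV Vr)) => r' Vr'.
  have [L' JL' _] := HV r r' Vr Vr'; exists (L + L'); exact: joined_trans Lr JL'.
- exists S; last by rewrite setTI.
  rewrite -openC openE => r nSr; have [V [phi [B [C [oV Vr _ _ HV]]]]] := chart_nbhd r.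
  apply: filterS (open_nbhs_nbhs (conj oV Vr)) => r' Vr' [L JL]; apply: nSr.
  have [L' JL' _] := HV r' r Vr' Vr; exists (L + L'); exact: joined_trans JL JL'.
Qed.

Lemma inner_metric_lt p q e : inner_metric g p q < e -> exists2 L, joined g p q L & L < e.
Proof.
move=> pqe; have hi : has_inf [set L | joined g p q L].
  by split; [exact: joined_exists|exists 0 => L; exact: joined_ge0].
have e0 : 0 < e - inner_metric g p q by rewrite subr_gt0.
have [L JL LE] := inf_adherent e0 hi; exists L => //.
by rewrite (lt_le_trans LE)// addrC subrK.
Qed.

Lemma inner_metric_triangle q p r :
  inner_metric g p r <= inner_metric g p q + inner_metric g q r.
Proof.
apply/ler_addgt0Pr => e e0.
have [L1 J1 l1] := @inner_metric_lt p q (inner_metric g p q + e / 2)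
  (ltac:(by rewrite ltrDl divr_gt0)).
have [L2 J2 l2] := @inner_metric_lt q r (inner_metric g q r + e / 2)
  (ltac:(by rewrite ltrDl divr_gt0)).
rewrite (le_trans (inner_metric_le (joined_trans J1 J2)))//; lra.
Qed.

Lemma inner_metric_nbhs p V : nbhs p V ->
  exists2 eps, 0 < eps & forall q, inner_metric g p q < eps -> V q.
Proof.
move=> /chart_escape[eps e0 H]; exists eps => // q /inner_metric_lt[L JL Le].
exact: H JL Le.
Qed.

(** Cut a curve of length less than [r] at the parameter where its arc length is
[s]. *)
Lemma inner_metric_split p q s r : 0 < s -> s <= r -> inner_metric g p q < r ->
  exists2 z, inner_metric g p z <= s & inner_metric g z q <= r - s.
Proof.
move=> s0 sr /inner_metric_lt[L /joinedP[a [b [c [l [ab sc [ca cb] dl LE]]]]] Lr].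
have [Ls|sL] := leP L s.
  exists q; last by rewrite inner_metric_refl subr_ge0.
  rewrite (le_trans _ Ls)//; apply: inner_metric_le; apply/joinedP.
  by exists a, b, c, l.
have [|t tab tE] := @IVT _ l a b (l a + s) (ltW ab) (arc_length_continuous dl).
  rewrite min_l ?max_r; try by rewrite (arc_length_nondecreasing dl)// ltW.
  by apply/andP; split; lra.
move: tab; rewrite in_itv/= => /andP[at_ tb].
have at' : a < t.
  by rewrite lt_neqAle at_ andbT; apply/eqP => E; move: tE; rewrite -E; lra.
have tb' : t < b.
  by rewrite lt_neqAle tb andbT; apply/eqP => E; move: tE; rewrite E; lra.
exists (c t).
  apply: inner_metric_le; apply/joinedP; exists a, t, c, l; split => //.
  - exact: smooth_curve_sub sc.
  - exact: arc_length_function_sub dl.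
  - by rewrite tE addrC addKr.
have -> : r - s = r - L + (L - s) by ring.
apply: ler_wpDl; first by rewrite subr_ge0 ltW.
apply: inner_metric_le; apply/joinedP.
exists t, b, c, l; split => //.
- exact: smooth_curve_sub sc.
- exact: arc_length_function_sub dl.
- by rewrite tE LE; ring.
Qed.

End InnerMetric.

(** * Covering numbers of piecewise Lipschitz sets *)

Section ColouredCovers.
Context {R : realType} {T : Type}.
Variable d : T -> T -> R.
Implicit Types (S : set T) (eta : R).

(** The centers are taken in [S], one for every colour that occurs. *)
Lemma class_representatives S eta (F : Type) (psi : T -> F) x0 : S x0 ->
  (forall x y, S x -> S y -> psi x = psi y -> d x y <= eta) ->
  exists2 x : F -> T, forall f, S (x f) & forall y, S y -> d (x (psi y)) y <= eta.
Proof.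
move=> Sx0 H.
have /choice[x Hx] : forall f : F, exists x, S x /\
    ((exists2 y, S y & psi y = f) -> psi x = f).
  move=> f; have [[y Sy yf]|nf] := pselect (exists2 y, S y & psi y = f).
    by exists y.
  by exists x0.
exists x => [f|y Sy]; first by have [] := Hx f.
have [Sx Ex] := Hx (psi y); apply: H => //.
by apply: Ex; exists y.
Qed.

Lemma covering_number_set0_le eta (n : nat) : (covering_number set0 d eta <= n%:R%:E)%E.
Proof.
apply: (@le_trans _ _ 0%:R%:E); last by rewrite lee_fin ler_nat.
apply: ereal_inf_lbound; exists 0%N => //=.
by exists (fun i : 'I_0 => match ltac:(by case: i) : False with end); split => // -[].
Qed.

Lemma covering_number_le_card S eta (F : finType) (psi : T -> F) :
  (forall x y, S x -> S y -> psi x = psi y -> d x y <= eta) ->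
  (covering_number S d eta <= #|F|%:R%:E)%E.
Proof.
move=> H; have [->|/set0P[x0 Sx0]] := eqVneq S set0.
  exact: covering_number_set0_le.
have [x Sx Hx] := class_representatives Sx0 H.
apply: ereal_inf_lbound; exists #|F| => //=.
exists (fun i => x (enum_val i)); split=> // y Sy.
by exists (enum_rank (psi y)) => //=; rewrite enum_rankK; exact: Hx.
Qed.

Lemma ereal_inf_nat_le (a : \bar R) (r : nat) (P : set nat) : (0 < r)%N ->
  (forall n, P n -> (a <= (r * n)%:R%:E)%E) ->
  (a <= r%:R%:E * ereal_inf [set n%:R%:E | n in P])%E.
Proof.
move=> r0 H; have r0' : 0 < r%:R :> R by rewrite ltr0n.
rewrite -lee_pdivrMl//; apply: le_ereal_inf_tmp => _ [n Pn <-].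
by rewrite lee_pdivrMl// -EFinM -natrM; exact: H.
Qed.

Context {m : nat}.

(** The pieces are the colour classes of [kappa]; keeping a single colouring and a
single coordinate map on the whole set avoids families of charts. *)
Definition piecewise_lipschitz S : Prop :=
  exists (r : nat) (kappa : T -> nat) (phi : T -> 'rV[R]_m) (B delta : R),
    [/\ 0 < delta, forall x, S x -> (kappa x < r)%N, forall x, S x -> `|phi x| <= B &
      forall x y, S x -> S y -> kappa x = kappa y ->
        d x y <= delta * `|phi x - phi y|].

Lemma piecewise_lipschitz_subset S S' : S' `<=` S ->
  piecewise_lipschitz S -> piecewise_lipschitz S'.
Proof.
move=> SS' [r [k [phi [B [delta [d0 kr pB H]]]]]].
exists r, k, phi, B, delta; split=> // [x /SS'|x /SS'|x y /SS' Sx /SS' Sy].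
- exact: kr.
- exact: pB.
- exact: H.
Qed.

Lemma piecewise_lipschitz0 : piecewise_lipschitz set0.
Proof. by exists 0%N, (fun=> 0%N), (fun=> 0), 0, 1; split. Qed.

(** Points of the first set keep their colour, the other points of the second get
new ones. *)
Lemma piecewise_lipschitzU S1 S2 : piecewise_lipschitz S1 ->
  piecewise_lipschitz S2 -> piecewise_lipschitz (S1 `|` S2).
Proof.
move=> [r1 [k1 [phi1 [B1 [d1 [d10 kr1 pB1 H1]]]]]].
move=> [r2 [k2 [phi2 [B2 [d2 [d20 kr2 pB2 H2]]]]]].
exists (r1 + r2)%N, (fun x => if x \in S1 then k1 x else (r1 + k2 x)%N),
  (fun x => if x \in S1 then phi1 x else phi2 x), (Num.max B1 B2), (Num.max d1 d2).
have S2P x : (S1 `|` S2) x -> x \notin S1 -> S2 x.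
  by move=> [S1x|//] /negP[]; exact: mem_set.
split=> [|x Sx|x Sx|x y Sx Sy].
- by rewrite lt_max d10.
- case: ifPn => [/set_mem/kr1 xr|/(S2P _ Sx)/kr2 xr].
    by rewrite (leq_trans xr) ?leq_addr.
  by rewrite ltn_add2l.
- rewrite le_max; case: ifPn => [/set_mem/pB1 ->//|/(S2P _ Sx)/pB2 ->].
  by rewrite orbT.
- case: ifPn => [/set_mem Sx1|/(S2P _ Sx) Sx2];
  case: ifPn => [/set_mem Sy1|/(S2P _ Sy) Sy2].
  + move=> /(H1 x y Sx1 Sy1)/le_trans; apply.
    by rewrite ler_wpM2r// le_max lexx.
  + by move=> E; have := kr1 _ Sx1; rewrite E ltnNge leq_addr.
  + by move=> E; have := kr1 _ Sy1; rewrite -E ltnNge leq_addr.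
  + move=> /addnI /(H2 x y Sx2 Sy2)/le_trans; apply.
    by rewrite ler_wpM2r// le_max lexx orbT.
Qed.

Lemma piecewise_lipschitz_bigcup (I : choiceType) (s : seq I) (V : I -> set T) :
  (forall i, i \in s -> piecewise_lipschitz (V i)) ->
  piecewise_lipschitz (\bigcup_(i in [set` s]) V i).
Proof.
move=> H; rewrite bigcup_seq big_seq.
elim/big_ind : _ => [||i si]; [exact: piecewise_lipschitz0|exact: piecewise_lipschitzU|].
exact: H.
Qed.

(** Colour a point by its piece and by a ball of the given cover that contains its
coordinates.  Two points of the same colour have coordinates within twice the
radius, whence the constant [2 * delta].  Counting [r.+1] pieces
keeps the set of colours nonempty. *)
Lemma piecewise_lipschitz_covering_le S : piecewise_lipschitz S ->
  exists (K : set 'rV[R]_m) (r : nat) (delta : R), [/\ compact K, 0 < delta &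
    forall eta : R, 0 < eta ->
      (covering_number S d eta <=
       r%:R%:E * covering_number K (@euclidean_dist R m) (eta / delta))%E].
Proof.
move=> [r [k [phi [B [delta [d0 kr pB H]]]]]].
exists [set x | `|x - 0| <= B], r.+1, (2 * delta); split.
- exact: compact_row_ball.
- by rewrite mulr_gt0.
move=> eta eta0; apply: ereal_inf_nat_le => // n [y [_ yK]].
have [->|/set0P[x0 Sx0]] := eqVneq S set0.
  exact: covering_number_set0_le.
have jP x : S x -> exists j : 'I_n, euclidean_dist (y j) (phi x) <= eta / (2 * delta).
  move=> Sx; have /yK[j _ /= yj] : `|phi x - 0| <= B by rewrite subr0; exact: pB.
  by exists j.
have [j0 _] := jP _ Sx0.
pose j x := xget j0 [set j : 'I_n | euclidean_dist (y j) (phi x) <= eta / (2 * delta)].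
have Hj x : S x -> `|y (j x) - phi x| <= eta / (2 * delta).
  move=> /jP Ej; rewrite (le_trans (norm_le_euclidean _ _))//.
  exact: (xgetPex j0 Ej).
have := @covering_number_le_card S eta ('I_r.+1 * 'I_n)%type (fun x => (inord (k x), j x)).
rewrite card_prod !card_ord; apply => x x' Sx Sx' [kk jj].
have {}kk : k x = k x'.
  have := congr1 (@nat_of_ord _) kk; rewrite !inordK// ltnS ltnW ?kr//.
rewrite (le_trans (H x x' Sx Sx' kk))// mulrC -ler_pdivlMr//.
have -> : phi x - phi x' = (y (j x') - phi x') - (y (j x) - phi x).
  by rewrite jj opprB [RHS]addrC subrKA.
rewrite (le_trans (ler_normB _ _))// (le_trans (lerD (Hj _ Sx') (Hj _ Sx)))//.
by rewrite le_eqVlt; apply/orP; left; apply/eqP; field; rewrite gt_eqF.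
Qed.

(** Colour a point by its piece and by its cell in the grid of side [eta / delta];
[N] is the largest index of a cell that occurs in each direction. *)
Lemma grid_colouring S r (k : T -> nat) (phi : T -> 'rV[R]_m) (B delta eta : R) :
  0 < delta -> 0 < eta -> (forall x, S x -> (k x < r)%N) ->
  (forall x, S x -> `|phi x| <= B) ->
  (forall x y, S x -> S y -> k x = k y -> d x y <= delta * `|phi x - phi y|) ->
  let N := Num.truncn (2 * `|B| / (eta / delta)) in
  exists psi : T -> 'I_r.+1 * {ffun 'I_m -> 'I_N.+1},
    forall x y, S x -> S y -> psi x = psi y -> d x y <= eta.
Proof.
move=> d0 eta0 kr pB H; set h := eta / delta => N.
have h0 : 0 < h by rewrite divr_gt0.
pose cell x k := Num.truncn ((phi x 0 k + `|B|) / h).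
have shift_ge0 x i : S x -> 0 <= (phi x 0 i + `|B|) / h.
  move=> Sx; rewrite divr_ge0 ?(ltW h0)// -lerBlDr sub0r.
  have := le_trans (coord_norm_le (phi x) i) (le_trans (pB x Sx) (ler_norm B)).
  by rewrite ler_norml => /andP[].
have cellN x i : S x -> (cell x i < N.+1)%N.
  move=> Sx; rewrite ltnS; apply: le_truncn; rewrite ler_pM2r ?invr_gt0//.
  rewrite mulr_natl mulr2n lerD2r.
  exact: le_trans (ler_norm _) (le_trans (coord_norm_le (phi x) i) (le_trans (pB x Sx) (ler_norm B))).
exists (fun x => (inord (k x), [ffun i => inord (cell x i)])).
move=> x x' Sx Sx' [kk /ffunP cc].
have {}kk : k x = k x'.
  have := congr1 (@nat_of_ord _) kk; rewrite !inordK// ltnS ltnW ?kr//.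
rewrite (le_trans (H x x' Sx Sx' kk))// mulrC -ler_pdivlMr//.
apply: norm_le_coord => [|i]; first exact: ltW.
have {}cc : cell x i = cell x' i.
  have := congr1 (@nat_of_ord _) (cc i); rewrite !ffunE !inordK//; exact: cellN.
have /andP[l1 u1] := truncn_itv (shift_ge0 x i Sx).
have /andP[l2 u2] := truncn_itv (shift_ge0 x' i Sx').
rewrite -/(cell x i) cc in l1 u1; rewrite -/(cell x' i) in l2 u2.
rewrite -natr1 in u1 u2.
have -> : (phi x - phi x') 0 i =
    ((phi x 0 i + `|B|) / h - (phi x' 0 i + `|B|) / h) * h.
  by rewrite !mxE; field; rewrite gt_eqF.
rewrite normrM (gtr0_norm h0) ler_piMl ?(ltW h0)// ler_norml.
by apply/andP; split; lra.
Qed.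

Lemma piecewise_lipschitz_net S eta x0 : piecewise_lipschitz S -> S x0 -> 0 < eta ->
  exists (F : finType) (psi : T -> F) (x : F -> T),
    (forall f, S (x f)) /\ (forall y, S y -> d (x (psi y)) y <= eta).
Proof.
move=> [r [k [phi [B [delta [d0 kr pB H]]]]]] Sx0 eta0.
have [psi psiP] := grid_colouring d0 eta0 kr pB H.
have [x Sx Hx] := class_representatives Sx0 psiP.
by eexists; exists psi, x.
Qed.

(** For [eta] at most the diameter, hence at most [D], the number of cells per
direction is at most [2 |B| delta / eta + 1 <= A / eta]. *)
Lemma piecewise_lipschitz_covering_polynomial S D : piecewise_lipschitz S ->
  (forall x y, S x -> S y -> d x y <= D) ->
  exists C : R, 0 < C /\ forall eta : R, 0 < eta ->
    (eta%:E <= diameter d S)%E ->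
    (covering_number S d eta <= (C * eta ^- m)%:E)%E.
Proof.
move=> [r [k [phi [B [delta [d0 kr pB H]]]]]] SD.
(* The summand 1 keeps the constant positive in all cases. *)
pose A := 2 * `|B| * delta + (`|D| + 1).
have A0 : 0 < A by rewrite ltr_wpDl ?ltr_wpDl// mulr_ge0 ?mulr_ge0// ltW.
exists (r.+1%:R * A ^+ m); split; first by rewrite mulr_gt0 ?exprn_gt0.
move=> eta eta0 etaD.
have {}etaD : eta <= `|D|.
  rewrite -lee_fin (le_trans etaD)//; apply: ge_ereal_sup => _ [x [y [Sx Sy ->]]].
  by rewrite lee_fin (le_trans (SD _ _ Sx Sy))// ler_norm.
have [psi psiP] := grid_colouring d0 eta0 kr pB H.
set N := Num.truncn _ in psi psiP.
have := covering_number_le_card psiP.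
rewrite card_prod card_ffun !card_ord => cov; apply: (le_trans cov) => {cov}.
rewrite lee_fin natrM natrX -mulrA ler_wpM2l// -exprVn -exprMn.
rewrite lerXn2r ?nnegrE ?divr_ge0// ?(ltW A0) ?(ltW eta0)//.
rewrite ler_pdivlMr//.
have /andP[NB _] := @truncn_itv R (2 * `|B| / (eta / delta))
  (ltac:(apply: divr_ge0; [by rewrite mulr_ge0|by rewrite ltW// divr_gt0])).
rewrite -/N in NB; rewrite -natr1 mulrDl mul1r lerD//; last first.
  by rewrite (le_trans etaD)// lerDl.
rewrite -ler_pdivlMr//; apply: (le_trans NB).
by rewrite le_eqVlt; apply/orP; left; apply/eqP; field; rewrite !gt_eqF.
Qed.

(** * Bounded sets in complete length metrics *)

Hypothesis d_ge0 : forall x y, 0 <= d x y.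
Hypothesis d_sym : forall x y, d x y = d y x.
Hypothesis d_triangle : forall y x z, d x z <= d x y + d y z.

(** Go through the representatives of the two colour classes; their finitely many
mutual distances are bounded by the sum of them all. *)
Lemma piecewise_lipschitz_bounded S : piecewise_lipschitz S ->
  exists D, forall x y, S x -> S y -> d x y <= D.
Proof.
move=> [r [k [phi [B [delta [d0 kr pB H]]]]]].
have [->|/set0P[x0 Sx0]] := eqVneq S set0; first by exists 0.
pose eta := delta * (B + B).
have [|x Sx Hx] := @class_representatives S eta 'I_r.+1 (fun x => inord (k x)) x0 Sx0.
  move=> x x' Sx Sx' kk.
  have {}kk : k x = k x'.
    have := congr1 (@nat_of_ord _) kk; rewrite !inordK// ltnS ltnW ?kr//.
  rewrite (le_trans (H x x' Sx Sx' kk))// (ler_wpM2l (ltW d0))//.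
  by rewrite (le_trans (ler_normB _ _))// lerD ?pB.
pose s := \sum_f \sum_f' d (x f) (x f').
have sP f f' : d (x f) (x f') <= s.
  rewrite /s (bigD1 f)//= (bigD1 f')//= -addrA lerDl addr_ge0//.
    by apply: sumr_ge0.
  by apply: sumr_ge0 => ? _; apply: sumr_ge0.
exists (eta + (s + eta)) => y z Sy Sz.
pose f := (inord (k y) : 'I_r.+1); pose f' := (inord (k z) : 'I_r.+1).
rewrite (le_trans (d_triangle (x f) _ _))// lerD//; first by rewrite d_sym; exact: Hx.
by rewrite (le_trans (d_triangle (x f') _ _))// lerD//; exact: Hx.
Qed.

Hypothesis d_refl : forall x, d x x = 0.
(** A length metric has approximate intermediate points; the admissible error is
the gap between [d x y] and [r]. *)
Hypothesis d_split : forall x y s r, 0 < s -> s <= r -> d x y < r ->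
  exists2 z, d x z <= s & d z y <= r - s.

Let cball x r := [set y | d x y <= r].

(** If the ball of radius [s <= r] is piecewise Lipschitz, it has a finite
[eps / 4]-net.  A point at distance at most [s + eps / 4] from [x] is, by
[d_split], within [eps / 2] of a point of that ball, hence in one of the
finitely many balls of radius [eps] around the net.  So the radius can be
increased by [eps / 4]. *)
Lemma piecewise_lipschitz_ball_spread x r eps : 0 < r -> 0 < eps ->
  (forall y, d x y <= r -> piecewise_lipschitz (cball y eps)) ->
  piecewise_lipschitz (cball x r).
Proof.
move=> r0 eps0 H.
suff key n : piecewise_lipschitz (cball x (Num.min r (eps + n%:R * (eps / 4)))).
  (* After this many steps the radius exceeds [r]. *)
  pose n := Num.truncn (r / (eps / 4)).
  apply: piecewise_lipschitz_subset (key n.+1) => y /= xy.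
  rewrite /cball/= le_min xy/= (le_trans xy)// ler_wpDl ?(ltW eps0)//.
  by rewrite -ler_pdivrMr ?divr_gt0// ltW// truncnS_gt.
elim: n => [|n IH].
  apply: piecewise_lipschitz_subset (H x _) => [y|]; last by rewrite d_refl ltW.
  by rewrite /cball/= mul0r addr0 le_min => /andP[].
set s := Num.min _ _ in IH.
have s0 : 0 < s by rewrite lt_min r0 ltr_wpDr// mulr_ge0// divr_ge0// ltW.
have sr : s <= r by rewrite ge_min lexx.
have Sx : cball x s x by rewrite /cball/= d_refl ltW.
have [|F [psi [y [Sy Hy]]]] := @piecewise_lipschitz_net (cball x s) (eps / 4) x IH Sx.
  by rewrite divr_gt0.
have HF : piecewise_lipschitz (\bigcup_(f in [set` enum F]) cball (y f) eps).
  apply: piecewise_lipschitz_bigcup => f _; apply: H.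
  by rewrite (le_trans (Sy f)).
apply: piecewise_lipschitz_subset HF => z; rewrite {1}/cball/= le_min => /andP[xzr xz].
have xzs : d x z < s + eps / 2.
  rewrite -ltrBlDr lt_min; apply/andP; split; first by lra.
  by rewrite -natr1 in xz; lra.
have [|w xw wz] := d_split s0 _ xzs; first by rewrite lerDl divr_ge0// ltW.
exists (psi w); first by rewrite /= mem_enum.
rewrite /cball/= (le_trans (d_triangle w _ _))//.
have := Hy w xw; lra.
Qed.

(** If a ball were not piecewise Lipschitz, there would be, by
[piecewise_lipschitz_ball_spread], balls of radius 2^-n that are not, each
centered in the previous one.  The centers converge, and eventually these balls
lie in a piecewise Lipschitz neighbourhood of the limit. *)
Lemma complete_ball_piecewise_lipschitz : metric_complete d ->
  (forall l, exists2 eps, 0 < eps & piecewise_lipschitz [set y | d l y < eps]) ->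
  forall x r, piecewise_lipschitz (cball x r).
Proof.
move=> d_complete d_local.
suff Hpos x r : 0 < r -> piecewise_lipschitz (cball x r).
  move=> x r; apply: piecewise_lipschitz_subset (Hpos x (Num.max r 1) _) => [y /= h|].
    by rewrite /cball/= le_max h.
  by rewrite lt_max ltr01 orbT.
move=> r0; apply: contrapT => bad.
have far x' r' eps : 0 < r' -> 0 < eps -> ~ piecewise_lipschitz (cball x' r') ->
    exists2 y, d x' y <= r' & ~ piecewise_lipschitz (cball y eps).
  move=> r'0 e0 nb; apply: contrapT => nex; apply: nb.
  apply: (@piecewise_lipschitz_ball_spread _ _ eps) => // y xy.
  by apply: contrapT => nP; apply: nex; exists y.
pose e n : R := 2^-1 ^+ n.
have e0 n : 0 < e n by rewrite exprn_gt0// invr_gt0.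
have eS n : e n = 2 * e n.+1 by rewrite /e exprS mulrA divff// mul1r.
have [y0 _ bad0] := far x r (e 0%N) r0 (e0 _) bad.
have /choice[f Hf] : forall ny : nat * T, exists y', ~ piecewise_lipschitz (cball ny.2 (e ny.1)) ->
    d ny.2 y' <= e ny.1 /\ ~ piecewise_lipschitz (cball y' (e ny.1.+1)).
  move=> [n y] /=; have [nb|nnb] := pselect (piecewise_lipschitz (cball y (e n))).
    by exists y.
  by have [y' dy ny'] := far y (e n) (e n.+1) (e0 _) (e0 _) nnb; exists y'.
pose u := fix u n := if n is n'.+1 then f (n', u n') else y0.
have ubad n : ~ piecewise_lipschitz (cball (u n) (e n)).
  by elim: n => [|n IH] //=; have [] := Hf (n, u n) IH.
have ustep n : d (u n) (u n.+1) <= e n by have [] := Hf (n, u n) (ubad n).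
have ufar n j : d (u n) (u (n + j)%N) <= 2 * (e n - e (n + j)%N).
  elim: j => [|j IH]; first by rewrite addn0 d_refl subrr mulr0.
  rewrite addnS (le_trans (d_triangle (u (n + j)%N) _ _))//.
  have := ustep (n + j)%N; have := eS (n + j)%N; lra.
have esmall eps : 0 < eps -> \forall n \near \oo, e n < eps.
  move=> eps0; have := near_infty_natSinv_expn_lt (PosNum eps0).
  by apply: filterS => n; rewrite /= div1r /e exprVn.
have [l ul] : exists l, d (u n) l @[n --> \oo] --> (0 : R).
  apply: d_complete => eps eps0.
  have [N _ HN] : \forall n \near \oo, e n < eps / 4 by apply: esmall; rewrite divr_gt0.
  exists N => k j Nk Nj.
  have hk n : (N <= n)%N -> d (u N) (u n) < 2 * e N.
    move=> Nn; have := ufar N (n - N)%N; rewrite subnKC//.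
    by have := e0 n; lra.
  rewrite (le_lt_trans (d_triangle (u N) _ _))// d_sym.
  have := hk _ Nk; have := hk _ Nj; have := HN N (leqnn N); rewrite /=; lra.
have [eps eps0 Heps] := d_local l.
have [n [un en]] : exists n, d (u n) l < eps / 2 /\ e n < eps / 2.
  have h0 : 0 < eps / 2 by rewrite divr_gt0.
  have H1 := esmall _ h0.
  have H2 : \forall n \near \oo, d (u n) l < eps / 2.
    move/cvgr0_norm_lt : ul => /(_ _ h0).
    by apply: filterS => n; exact: le_lt_trans (ler_norm _).
  near \oo => n; exists n; split; near: n; [exact: H2|exact: H1].
apply: (ubad n); apply: piecewise_lipschitz_subset Heps => y; rewrite /cball/= => uy.
rewrite (le_lt_trans (d_triangle (u n) _ _))// d_sym; lra.
Unshelve. all: by end_near. Qed.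

End ColouredCovers.

(** * Covering numbers for the inner metric *)

Section Coverings.
Context {R : realType} {m : nat} {M : topologicalType}.
Variables (A : smooth_manifold R m M) (g : riemannian_metric A).
Hypothesis M_connected : connected [set: M].

Lemma nbhs_piecewise_lipschitz (p : M) :
  exists V, [/\ open V, V p & piecewise_lipschitz (m := m) (inner_metric g) V].
Proof.
have [V [phi [B [C [oV Vp C0 VB HV]]]]] := chart_nbhd g p; exists V; split => //.
exists 1%N, (fun=> 0%N), phi, B, C; split => // x y Vx Vy _.
by have [L JL LC] := HV x y Vx Vy; rewrite (le_trans (inner_metric_le JL)).
Qed.

(** The sets containing some piecewise Lipschitz set form a filter [F] on the
subsets of [M], because finite unions are piecewise Lipschitz.  Every point
is locally absorbed by [F]-almost all sets, so by compactness [K] is contained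
in one of them. *)
Lemma precompact_piecewise_lipschitz (S : set M) : precompact S ->
  piecewise_lipschitz (m := m) (inner_metric g) S.
Proof.
move=> [K SK [/compact_near_coveringP cK _]].
pose F : set_system (set M) := [set Q | exists2 S0,
  piecewise_lipschitz (m := m) (inner_metric g) S0 & forall S', S0 `<=` S' -> Q S'].
have FF : Filter F.
  split.
  - by exists set0; first exact: piecewise_lipschitz0.
  - move=> P Q [S1 l1 H1] [S2 l2 H2]; exists (S1 `|` S2).
      exact: piecewise_lipschitzU.
    by move=> S'; rewrite subUset => -[/H1 ? /H2].
  - by move=> P Q PQ [S1 l1 H1]; exists S1 => // S' /H1 /PQ.
have [p Kp|S0 l0 HS0] := cK _ F (fun (S' : set M) p => S' p) FF.
  have [V [oV Vp lV]] := nbhs_piecewise_lipschitz p.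
  exists (V, [set S' | V `<=` S']); last by move=> [q S'] [/= Vq VS']; exact: VS'.
  split => /=; first exact: open_nbhs_nbhs.
  by exists V.
apply: piecewise_lipschitz_subset l0 => p /SK Kp.
exact: (HS0 S0).
Qed.

Lemma bounded_piecewise_lipschitz (S : set M) : metric_complete (inner_metric g) ->
  metric_bounded (inner_metric g) S -> piecewise_lipschitz (m := m) (inner_metric g) S.
Proof.
move=> dc [B SB]; have [->|/set0P[p Sp]] := eqVneq S set0.
  exact: piecewise_lipschitz0.
suff : piecewise_lipschitz (m := m) (inner_metric g) [set q | inner_metric g p q <= B].
  by apply: piecewise_lipschitz_subset => q Sq; exact: SB.
apply: complete_ball_piecewise_lipschitz => //.
- exact: inner_metric_sym.
- exact: inner_metric_triangle.
- exact: inner_metric_refl.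
- by move=> x y s r s0 sr /(inner_metric_split M_connected s0 sr).
- move=> l; have [V [oV Vl HV]] := nbhs_piecewise_lipschitz l.
  have [eps e0 He] := inner_metric_nbhs g M_connected (open_nbhs_nbhs (conj oV Vl)).
  by exists eps => //; exact: piecewise_lipschitz_subset HV.
Qed.

End Coverings.

Theorem proposition3p1 (R : realType) (m : nat) (M : topologicalType)
    (A : smooth_manifold R m M) (g : riemannian_metric A)
    (M_connected : connected [set: M]) :
  (forall Theta : set M, precompact Theta ->
     (exists (K : set 'rV[R]_m) (r : nat) (delta : R),
        [/\ compact K, 0 < delta &
          forall eta : R, 0 < eta ->
            (covering_number Theta (inner_metric g) eta <=
             r%:R%:E * covering_number K (@euclidean_dist R m) (eta / delta))%E])
     /\
     (exists C : R, 0 < C /\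
        forall eta : R, 0 < eta ->
          (eta%:E <= diameter (inner_metric g) Theta)%E ->
          (covering_number Theta (inner_metric g) eta <= (C * eta ^- m)%:E)%E))
  /\
  (metric_complete (inner_metric g) ->
   forall Theta : set M, metric_bounded (inner_metric g) Theta ->
     exists C : R, 0 < C /\
       forall eta : R, 0 < eta ->
         (eta%:E <= diameter (inner_metric g) Theta)%E ->
         (covering_number Theta (inner_metric g) eta <= (C * eta ^- m)%:E)%E).
Proof.
split=> [S pS|dc S bS].
  have lS := precompact_piecewise_lipschitz g pS.
  split; first exact: piecewise_lipschitz_covering_le.
  have [|||D HD] := piecewise_lipschitz_bounded _ _ _ lS.
  - exact: inner_metric_ge0.
  - exact: inner_metric_sym.
  - exact: inner_metric_triangle.
  exact: piecewise_lipschitz_covering_polynomial lS HD.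
have [D HD] := bS.
exact: piecewise_lipschitz_covering_polynomial
  (bounded_piecewise_lipschitz M_connected dc bS) HD.
Qed.
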